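(* Let $\alpha=\frac12$ and $$\hat r_0=\mathbf 1_1,\quad \hat r_1=\begin{pmatrix}1&0\\0&-1\end{pmatrix},\quad \hat r_2=\begin{pmatrix}0&1\\1&0\end{pmatrix},\quad \hat r_3=\begin{pmatrix}0&-1\\1&0\end{pmatrix}.$$ Then the Haar system $\mathbf h_{\frac12}=\mathbf h_{\frac12}(\hat r_0,\hat r_1,\hat r_2,\hat r_3)=\{h_j\}_{j\ge0}\subseteq\mathcal R_{\frac12}$ is a Schauder basis of the predual of the hyperfinite $\mathrm{II}_1$ factor $\mathcal R_{\frac12}$, where $\mathcal R_{\frac12}$ is embedded in its predual by $x\mapsto\rho_{\frac12}(\cdot\,x)=\rho_{\frac12}(x\,\cdot)$.
   Context: For $\nu\ge1$ let $\mathcal N_\nu$ be the algebra of complex $2^\nu\times2^\nu$ matrices with unit $\mathbf 1_\nu$, with $\mathcal N_\nu\otimes\mathcal N_\mu=\mathcal N_{\nu+\mu}$ via the Kronecker product; for $\alpha=\frac12$, $\rho_\nu(x)=2^{-\nu}\mathrm{Tr}(x)$; $i_\nu:\mathcal N_\nu\to\mathcal N_{\nu+1}$, $i_\nu(x)=x\otimes\mathbf 1_1$. $\mathcal R_{\frac12}$ is the von Neumann algebra generated by the GNS representation of the $C^*$-inductive limit of $(\mathcal N_\nu,i_\nu)$ with respect to the tracial state $\rho_{\frac12}$ induced by the states $\rho_\nu$; it is the hyperfinite factor of type $\mathrm{II}_1$ with faithful normal tracial state $\rho_{\frac12}$, and $\pi_\nu:\mathcal N_\nu\to\mathcal R_{\frac12}$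 are the canonical embeddings. Matrix units in shell enumeration: $\{e^{(\nu)}_m\}_{0\le m<4^\nu}$, where the matrix unit with entry $1$ in row $a$, column $b$ ($1\le a,b\le2^\nu$) gets index $m=s(a,b)-1$, with $s(a,b)=(b-1)^2+a$ if $a\le b$ and $s(a,b)=a^2-b+1$ if $a>b$. Haar system constructed from $r_0=\mathbf 1_1,r_1,r_2,r_3\in\mathcal N_1$ (here $r_j=\hat r_j$): $\mathbf h_1=\{r_0,r_1,r_2,r_3\}$ and, inductively, for $j=4^\nu q+k$ with $0\le q\le3$, $0\le k<4^\nu$, $h^{(\nu+1)}_j=i_\nu(h^{(\nu)}_k)(\mathbf 1_\nu\otimes r_0)$ if $q=0$ and $h^{(\nu+1)}_j=i_\nu(e^{(\nu)}_k)(\mathbf 1_\nu\otimes r_q)$ if $q\ne0$. Since $r_0=\mathbf 1_1$, $h^{(\nu+1)}_j=i_\nu(h^{(\nu)}_j)$ for $j<4^\nu$, and $h_j:=\pi_\nu(h^{(\nu)}_j)$ for any $\nu$ with $j<4^\nu$. *)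

(* Defs.v *)
From HB Require Import structures.
From mathcomp Require Import all_boot all_order all_algebra sesquilinear.
From mathcomp Require Import all_classical all_reals all_analysis.
From mathcomp Require Import complex mxtens.

Set Implicit Arguments.
Unset Strict Implicit.
Unset Printing Implicit Defensive.

Import Order.TTheory GRing.Theory Num.Theory Num.Def.
Import numFieldNormedType.Exports.

Local Open Scope classical_set_scope.
Local Open Scope ring_scope.
Local Open Scope complex_scope.

(** * The matrix algebras and the Haar system

   The algebras N_nu, nu >= 1, over the complex numbers R[i] are indexed by
   n = nu - 1: [matalg R n] is N_(n + 1). *)

Notation matalg R n := 'M[R[i]]_(2 ^ n.+1).

Section Matrices.
Variable R : realType.

Definition kron n (x : matalg R n) (y : 'M[R[i]]_2) : matalg R n.+1 :=
  castmx (esym (expnSr 2 n.+1), esym (expnSr 2 n.+1)) (x *t y).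

Definition amplify n (x : matalg R n) : matalg R n.+1 := kron x 1%:M.

(* Shell enumeration of pairs of positive integers, for which neither
   subtraction is truncated. *)
Definition shell (a b : nat) : nat :=
  if (a <= b)%N then ((b - 1) ^ 2 + a)%N else (a ^ 2 - b + 1)%N.

(* The matrix unit e_m: its nonzero entry is at the 1-based position (a, b)
   with shell a b = m + 1. *)
Definition mxunit n (m : nat) : matalg R n :=
  \matrix_(a, b) (shell a.+1 b.+1 == m.+1)%:R.

(* [haar r n j] is h_j^(n + 1), built from r 0, ..., r 3 and meaningful for
   j < 4 ^ n.+1. *)
Fixpoint haar (r : nat -> 'M[R[i]]_2) (n j : nat) : matalg R n :=
  match n with
  | 0 => r j
  | n'.+1 =>
      let q := (j %/ 4 ^ n'.+1)%N in
      let k := (j %% 4 ^ n'.+1)%N in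
      (if q == 0%N then amplify (haar r n' k) else amplify (mxunit n' k))
        *m kron 1%:M (r q)
  end.

Definition mx2 (a b c d : R[i]) : 'M[R[i]]_2 :=
  \matrix_(i, j) if i == 0 then (if j == 0 then a else b)
                 else (if j == 0 then c else d).

Definition rhat : nat -> 'M[R[i]]_2 :=
  nth 0 [:: 1%:M; mx2 1 0 0 (-1); mx2 0 1 1 0; mx2 0 (-1) 1 0].

Lemma kron11 n : kron (1%:M : matalg R n) 1%:M = 1%:M.
Proof.
rewrite /kron; apply/matrixP => i j; rewrite castmxE !mxE -natrM mulnb.
congr (_%:R); rewrite -!val_eqE /= -xpair_eqE; congr nat_of_bool.
apply/eqP/eqP => [[ij1 ij2]|-> //].
by rewrite (divn_eq i 2) (divn_eq j 2) ij1 ij2.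
Qed.

Lemma haar_rhat_amplify n j : (j < 4 ^ n.+1)%N ->
  haar rhat n.+1 j = amplify (haar rhat n j).
Proof. by move=> jn /=; rewrite divn_small //= modn_small // kron11 mulmx1. Qed.

End Matrices.

(** * C*-algebras *)

(* Unital C*-algebra structures on a complex Banach space; the ring and the
   normed module structures of the libraries have no common join. *)
Record cstar (R : realType) (A : completeNormedModType R[i]) := CStar {
  cmul : A -> A -> A;
  cone : A;
  cadj : A -> A;
  cmulA : associative cmul;
  cmul1l : left_id cone cmul;
  cmul1r : right_id cone cmul;
  cmul_linearl : forall (c : R[i]) (a b x : A),
    cmul (c *: a + b) x = c *: cmul a x + cmul b x;
  cmul_linearr : forall (c : R[i]) (a b x : A),
    cmul x (c *: a + b) = c *: cmul x a + cmul x b;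
  cadjK : involutive cadj;
  cadj_antilinear : forall (c : R[i]) (a b : A),
    cadj (c *: a + b) = conjC c *: cadj a + cadj b;
  cadjM : forall a b : A, cadj (cmul a b) = cmul (cadj b) (cadj a);
  cnormM : forall a b : A, `|cmul a b| <= `|a| * `|b|;
  cnorm_cstar : forall a : A, `|cmul (cadj a) a| = `|a| ^+ 2;
}.

(* A, with the canonical maps iota, is the C*-inductive limit of the matrix
   algebras along the connecting maps [amplify]. *)
Record cstar_inductive_limit (R : realType) (A : completeNormedModType R[i])
    (cs : cstar A) (iota : forall n, matalg R n -> A) : Prop :=
    CstarInductiveLimit {
  iota_linear : forall n (c : R[i]) (x y : matalg R n),
    iota n (c *: x + y) = c *: iota n x + iota n y;
  iota_mul : forall n (x y : matalg R n),
    iota n (x *m y) = cmul cs (iota n x) (iota n y);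
  iota_one : forall n, iota n 1%:M = cone cs;
  iota_adj : forall n (x : matalg R n),
    iota n (map_mx conjC x^T) = cadj cs (iota n x);
  iota_inj : forall n, injective (iota n);
  iota_compat : forall n (x : matalg R n), iota n.+1 (amplify x) = iota n x;
  iota_dense : closure (\bigcup_n range (iota n)) = setT
}.

Record is_state (R : realType) (A : completeNormedModType R[i])
    (cs : cstar A) (rho : A -> R[i]) : Prop := IsState {
  state_linear : forall (c : R[i]) (a b : A),
    rho (c *: a + b) = c * rho a + rho b;
  state_ge0 : forall a : A, 0 <= rho (cmul cs (cadj cs a) a);
  state_one : rho (cone cs) = 1;
  state_bounded : forall a : A, `|rho a| <= `|a|
}.

(* The state induced by the normalized traces. *)
Definition induced_trace_state (R : realType) (A : completeNormedModType R[i])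
    (cs : cstar A) (iota : forall n, matalg R n -> A) (rho : A -> R[i]) : Prop :=
  is_state cs rho /\
  forall n (x : matalg R n), rho (iota n x) = (2 ^+ n.+1)^-1 * \tr x.

(** * Operators on a Hilbert space and von Neumann algebras *)

Section Operators.
Variables (R : realType) (H : completeNormedModType R[i]).
Variable ip : {dot H for @conjC R[i]}.

(* H is a Hilbert space for ip, which is linear in its first argument. *)
Definition hilbert_norm : Prop := forall xi : H, ip xi xi = `|xi| ^+ 2.

Definition bounded_operator (T : H -> H) : Prop := linear T /\ continuous T.

Definition commutant (S : set (H -> H)) : set (H -> H) :=
  [set T | bounded_operator T /\ forall x, S x -> T \o x = x \o T].

Definition adjoint_pair (x y : H -> H) : Prop :=
  forall xi eta, ip (x xi) eta = ip xi (y eta).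

Definition von_neumann_algebra (M : set (H -> H)) : Prop :=
  (forall x, M x -> exists2 y, M y & adjoint_pair x y) /\
  commutant (commutant M) = M.

Definition vn_generated (S : set (H -> H)) : set (H -> H) :=
  \bigcap_(M in [set M | von_neumann_algebra M /\ S `<=` M]) M.

Definition square_summable (xi : nat -> H) : Prop :=
  cvgn (series (fun n => `|xi n| ^+ 2 : R[i]^o)).

(* The functionals defining the ultraweak (sigma-weak) topology. *)
Definition omega_uw (p : (nat -> H) * (nat -> H)) (x : H -> H) : R[i]^o :=
  limn (series (fun n => ip (x (p.1 n)) (p.2 n) : R[i]^o)).

Variable M : set (H -> H).

(* Continuity for the coarsest topology making all the functionals
   [omega_uw p], p a pair of square-summable sequences, continuous. *)
Definition ultraweakly_continuous (phi : M -> R[i]^o) : Prop :=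
  forall (x0 : M) (eps : R), 0 < eps ->
  exists (s : seq ((nat -> H) * (nat -> H))) (delta : R),
    [/\ 0 < delta,
        forall p, p \in s -> square_summable p.1 /\ square_summable p.2 &
        forall x : M,
          (forall p, p \in s ->
             `|omega_uw p (val x) - omega_uw p (val x0)| < delta%:C) ->
          `|phi x - phi x0| < eps%:C].

(* M is only a set of operators; z = c x + y is an equation in B(H). *)
Definition vn_linear (phi : M -> R[i]^o) : Prop :=
  forall (c : R[i]) (x y z : M),
    (forall xi, val z xi = c *: val x xi + val y xi) ->
    phi z = c * phi x + phi y.

Definition predual : set (M -> R[i]^o) :=
  [set phi | vn_linear phi /\ ultraweakly_continuous phi].

(* The norm of a functional on M: the supremum of |phi x| over the operator
   norm unit ball of M. *)
Definition dual_norm (phi : M -> R[i]^o) : \bar R :=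
  ereal_sup [set (complex.Re `|phi x|)%:E |
              x in [set x : M | forall xi : H, `|val x xi| <= `|xi|]].

End Operators.

Definition schauder_basis (R : realType) (V : lmodType R[i]) (X : set V)
    (nrm : V -> \bar R) (e : nat -> V) : Prop :=
  (forall j, X (e j)) /\
  forall v, X v -> exists! c : nat -> R[i],
    (fun n => nrm (v - \sum_(j < n) c j *: e j)) @ \oo --> 0%E.

(** * The GNS representation and the factor it generates *)

Record is_gns (R : realType) (A : completeNormedModType R[i])
    (cs : cstar A) (rho : A -> R[i])
    (H : completeNormedModType R[i]) (ip : {dot H for @conjC R[i]})
    (pi : A -> H -> H) (Omega : H) : Prop := IsGns {
  gns_hilbert : hilbert_norm ip;
  gns_bounded : forall a, bounded_operator (pi a);
  gns_linear : forall (c : R[i]) (a b : A) (xi : H),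
    pi (c *: a + b) xi = c *: pi a xi + pi b xi;
  gns_mul : forall a b : A, pi (cmul cs a b) = pi a \o pi b;
  gns_adj : forall a : A, adjoint_pair ip (pi a) (pi (cadj cs a));
  gns_cyclic : closure (range (fun a => pi a Omega)) = setT;
  gns_state : forall a : A, rho a = ip (pi a Omega) Omega
}.

Section Factor.
Variables (R : realType) (A : completeNormedModType R[i]).
Variable iota : forall n, matalg R n -> A.
Variables (H : completeNormedModType R[i]) (ip : {dot H for @conjC R[i]}).
Variables (pi : A -> H -> H) (Omega : H).

Definition gns_factor : set (H -> H) := vn_generated ip (range pi).

Lemma gns_factor_mem (a : A) : pi a \in gns_factor.
Proof. by apply/mem_set => M [_]; apply; exists a. Qed.

Definition pi_ n (x : matalg R n) : gns_factor :=
  SigSub (gns_factor_mem (iota x)).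

Definition haar_factor (r : nat -> 'M[R[i]]_2) (j : nat) : gns_factor :=
  pi_ (haar r j j).

(* As r_0 = 1, the choice of the level at which h_j is taken is irrelevant. *)
Lemma haar_factorE (cs : cstar A) : cstar_inductive_limit cs iota ->
  forall n j, (j < 4 ^ n.+1)%N ->
    haar_factor (@rhat R) j = pi_ (haar (@rhat R) n j).
Proof.
move=> [_ _ _ _ _ iotaE _].
have step m n j : (j < 4 ^ n.+1)%N ->
    iota (haar (@rhat R) (m + n) j) = iota (haar (@rhat R) n j).
  move=> jn; elim: m => // m <-; rewrite addSn haar_rhat_amplify ?iotaE //.
  by rewrite (leq_trans jn)// leq_exp2l// ltnS leq_addl.
have jj j : (j < 4 ^ j.+1)%N by rewrite (ltn_trans (ltnSn j))// ltn_expl.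
move=> n j jn; apply/val_inj => /=; congr pi.
have [nj|/ltnW nj] := leqP n j.
  by have := step (j - n)%N n j jn; rewrite subnK.
by have := step (n - j)%N j j (jj j); rewrite subnK.
Qed.

(* The normal extension of rho to the factor is the vector state of Omega. *)
Definition rho_vec (T : H -> H) : R[i] := ip (T Omega) Omega.

(* x |-> rho( . x) *)
Definition embed (x : gns_factor) : gns_factor -> R[i]^o :=
  fun y => rho_vec (val y \o val x).

End Factor.

(* Main.v *)
From HB Require Import structures.
Require Import Defs.
From mathcomp Require Import all_boot all_order all_algebra sesquilinear.
From mathcomp Require Import all_classical all_reals all_analysis.
From mathcomp Require Import complex mxtens.
From mathcomp Require Import ring lra zify.

(** Why the Haar system is a Schauder basis.

    Write [tau T = ip (T Omega) Omega], let [g_j] be the adjoint of [h_j], and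
    let [w j = rho (g_j h_j)].  The matrices [h_j] are orthogonal for the inner
    product that sends [x] and [y] to [rho (y^* x)]
    ([haar_ortho], [haar_rho_ortho]), and every matrix of level [n] is the sum of
    its expansion along the [g_j] with [j < 4 ^ n.+1] ([haar_complete]).  So the
    only possible coefficients of a functional [phi] are
    [c j = phi g_j / w j] ([haar_coef_unique]), and the [m]-th partial sum of
    the expansion of [phi] is the functional [T |-> phi (S m T)] with
    [S m T = \sum_(j < m) (tau (T h_j) / w j) g_j] ([partial_sum]).  What has
    to be shown is that [phi (T - S m T)] tends to [0] uniformly on the unit
    ball of the factor.

    This rests on two facts.

    - Uniform boundedness ([partial_sum_bound]): [S m] is bounded for the
      operator norm by a constant independent of [m >= 4].  For
      [4 ^ n.+1 <= m < 4 ^ n.+2], [S m T] depends only on the conditional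
      expectation of [T] onto level [n.+1], whose norm is at most that of [T]
      ([cond_exp_bounded]); as [h_j] at level [n.+1] is [x] tensor [r_q] with
      [j = 4 ^ n.+1 * q + k], [S m T] is a sum of at most three complete slices
      [b_p] tensor [r_p^*] and of one slice truncated to the first [k] matrix
      units ([form_bounded_haar_sum]).  In the shell enumeration such a
      truncation is a sum of three compressions [P b Q] to coordinate
      rectangles ([shell_corner], [form_bounded_shell]), hence it multiplies
      norms by at most [3].

    - Exactness on a dense set ([partial_sum_exact]): for [c] of level [n] and
      [m >= 4 ^ n.+1], [tau (S m T c) = tau (T c)].

    An ultraweakly continuous [phi] is small where finitely many functionals
    [omega_uw p] are, so it suffices to treat these; square summability reduces
    them to finitely many vector functionals [T |-> ip (T xi) eta], and density
    of the vectors [pi (iota c) Omega] reduces those, by the two facts, to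
    [T |-> tau (T c)] ([remainder_omega]).

    The rest is the elementary theory of the factor.  Riesz representation gives
    adjoints of bounded operators ([adjoint_exists]), so that the factor is the
    double commutant of [pi A] ([gns_factorE]).  Because [rho] is tracial, right
    multiplications extend to bounded operators in the commutant
    ([right_multiplication]); hence [Omega] is separating, which makes the
    embedding injective, and [tau] is a trace on the double commutant
    ([Omega_separating], [double_commutant_tracial]). *)

Set Implicit Arguments.
Unset Strict Implicit.
Unset Printing Implicit Defensive.

Import Order.TTheory GRing.Theory Num.Theory.
Import numFieldNormedType.Exports.

Local Open Scope classical_set_scope.
Local Open Scope complex_scope.
Local Open Scope ring_scope.

(** * Complex scalars *)

Section ComplexNumbers.
Variable R : realType.
Implicit Types z : R[i].

Lemma Re_norm (V : normedZmodType R[i]) (x : V) : (complex.Re `|x|)%:C = `|x|.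
Proof. by rewrite RRe_real// ger0_real. Qed.

Lemma Re_le_norm z : `|complex.Re z|%:C <= `|z|.
Proof.
by rewrite normc_def lecR -sqrtr_sqr ler_sqrt ?addr_ge0 ?sqr_ge0// lerDl sqr_ge0.
Qed.

Lemma ltC0P z : 0 < z -> exists2 e : R, 0 < e & z = e%:C.
Proof.
move=> z0; exists (complex.Re z); last by rewrite RRe_real// gtr0_real.
by move: z0; rewrite ltcE => /andP[].
Qed.

(** Limiting arguments take the form of this lemma: approximations within [e]
    give an estimate [K * e]. *)
Lemma eq0_small (F : numFieldType) (V : normedZmodType F) (x : V) (K : F) :
  0 <= K -> (forall e : F, 0 < e -> `|x| <= K * e) -> x = 0.
Proof.
move=> K0 h; apply/eqP/negPn/negP => x0.
have n0 : 0 < `|x| by rewrite normr_gt0.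
have K1 : 0 < 2 * (K + 1) by rewrite mulr_gt0// ltr_wpDl.
have := h (`|x| / (2 * (K + 1))); rewrite divr_gt0// => /(_ isT).
rewrite mulrCA ler_pMr// ler_pdivlMr// mul1r mulrDr mulr1 mulr_natl mulr2n.
rewrite -addrA gerDl => h1.
have : 0 < K + 2 by rewrite ltr_wpDl.
by move/(lt_le_trans)/(_ h1); rewrite ltxx.
Qed.

Lemma mulr_le_sumsq (p q : R[i]) : 0 <= p -> 0 <= q -> p * q <= p ^+ 2 + q ^+ 2.
Proof.
move=> p0 q0; apply: le_trans (_ : _ <= 2 * (p * q)) _.
  by rewrite ler_peMl ?mulr_ge0// ler1n.
rewrite -subr_ge0 (_ : _ - _ = (p - q) ^+ 2); last by ring.
by rewrite real_exprn_even_ge0// rpredB// ger0_real.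
Qed.

End ComplexNumbers.

(** * Inner products and approximation *)

Section Hilbert.
Variables (R : realType) (H : completeNormedModType R[i]).
Variable ip : {dot H for @Num.conj R[i]}.
Hypothesis hilb : hilbert_norm ip.
Implicit Types u v w : H.

Lemma ipC u v : ip u v = (ip v u)^*.
Proof. by rewrite hermC/= expr0 mul1r. Qed.

Lemma ipDl u v w : ip (u + v) w = ip u w + ip v w.
Proof. exact: linearDl. Qed.
Lemma ipBl u v w : ip (u - v) w = ip u w - ip v w.
Proof. exact: linearBl. Qed.
Lemma ipZl c u w : ip (c *: u) w = c * ip u w.
Proof. exact: linearZl_LR. Qed.
Lemma ip0l w : ip 0 w = 0.
Proof. exact: linear0l. Qed.
Lemma ipDr u v w : ip w (u + v) = ip w u + ip w v.
Proof. exact: linearDr. Qed.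
Lemma ipBr u v w : ip w (u - v) = ip w u - ip w v.
Proof. exact: linearBr. Qed.
Lemma ipZr c u w : ip w (c *: u) = c^* * ip w u.
Proof. exact: linearZr_LR. Qed.
Lemma ip0r w : ip w 0 = 0.
Proof. exact: linear0r. Qed.

Lemma dot_inj (u v : H) : (forall w, ip w u = ip w v) -> u = v.
Proof.
move=> h; apply/eqP; rewrite -subr_eq0 -(dnorm_eq0 ip).
by rewrite ipBr h subrr.
Qed.

Lemma cauchy_schwarz u v : `|ip u v| <= `|u| * `|v|.
Proof.
have [->|v0] := eqVneq v 0; first by rewrite ip0r !normr0 mulr0.
have nv : 0 < `|v| ^+ 2 by rewrite exprn_gt0// normr_gt0.
have nv0 : `|v| ^+ 2 != 0 by rewrite gt_eqF.
pose a := ip u v / `|v| ^+ 2.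
have : 0 <= ip (u - a *: v) (u - a *: v) by rewrite hilb exprn_ge0.
have vu : ip v u = (ip u v)^* by rewrite ipC.
have ca : a^* = (ip u v)^* / `|v| ^+ 2.
  rewrite /a rmorphM/= fmorphV; congr (_ / _).
  by apply/CrealP; rewrite rpredX// normr_real.
rewrite ipBl !ipBr !ipZl !ipZr !hilb vu ca.
have -> : `|u| ^+ 2 - (ip u v)^* / `|v| ^+ 2 * ip u v -
    (a * (ip u v)^* - a * ((ip u v)^* / `|v| ^+ 2 * `|v| ^+ 2)) =
    `|u| ^+ 2 - `|ip u v| ^+ 2 / `|v| ^+ 2.
  by rewrite divfK// subrr subr0 normCK mulrAC [_^* * _]mulrC.
rewrite subr_ge0 ler_pdivrMr// -exprMn ler_sqr// ?nnegrE ?mulr_ge0//.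
Qed.

End Hilbert.

Section Approximation.
Variable R : realType.

Lemma invn_small (e : R[i]) : 0 < e ->
  exists N : nat, forall n, (N <= n)%N -> (n.+1%:R^-1 : R[i]) <= e.
Proof.
move=> /ltC0P[r r0 ->].
have [N _ hN] := near_infty_natSinv_lt (PosNum r0).
exists N => n /hN /= /ltW h.
by rewrite -[n.+1%:R](rmorph_nat (real_complex R)) -fmorphV lecR.
Qed.

Lemma closure_approx (V : normedModType R[i]) (S : set V) : closure S = setT ->
  forall v (e : R[i]), 0 < e -> exists2 s, S s & `|v - s| <= e.
Proof.
move=> hS v e e0; have : closure S v by rewrite hS.
move=> /(_ _ (nbhsx_ballx v e e0))[s [Ss]].
by rewrite -ball_normE /= => /ltW ?; exists s.
Qed.

Lemma cauchy_limit (V : completeNormedModType R[i]) (u : nat -> V) :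
  (forall e : R[i], 0 < e -> exists N : nat, forall m n, (N <= m)%N -> (N <= n)%N ->
     `|u m - u n| <= e) ->
  exists l, forall e : R[i], 0 < e -> exists N : nat, forall n, (N <= n)%N ->
     `|u n - l| <= e.
Proof.
move=> hu.
have /cauchy_cvgP/cvg_ex[l ul] : cauchy (u @ \oo).
  apply/cauchy_exP => e e0.
  have e2 : 0 < e / 2 by rewrite divr_gt0.
  have [N hN] := hu _ e2; exists (u N); exists N => // n /= Nn.
  rewrite -ball_normE /= (le_lt_trans (hN _ _ _ _))//.
  by rewrite ltr_pdivrMr// ltr_pMr// ltr1n.
exists l => e e0; move/cvgrPdist_le: ul => /(_ e e0)[N _ hN].
by exists N => n Nn; rewrite distrC; exact: hN.
Qed.

Lemma bounded_operator_bound (V : completeNormedModType R[i]) (T : V -> V) :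
  bounded_operator T -> exists2 K : R[i], 0 < K & forall v, `|T v| <= K * `|v|.
Proof.
move=> [lT cT].
pose f : {linear V -> V} := HB.pack T (GRing.isLinear.Build _ _ _ _ T lT).
have : bounded_near f (nbhs (0 : V)) by apply: continuous_linear_bounded; exact: cT.
by move=> /linear_boundedP/pinfty_ex_gt0.
Qed.

Lemma bound_bounded_operator (V : completeNormedModType R[i]) (T : V -> V)
    (K : R[i]) : linear T -> (forall v, `|T v| <= K * `|v|) -> bounded_operator T.
Proof.
move=> lT hT; split=> //.
pose f : {linear V -> V} := HB.pack T (GRing.isLinear.Build _ _ _ _ T lT).
apply: (@bounded_linear_continuous _ _ _ f).
have [->|/eqP nz] := pselect (f = (fun=> 0) :> (V -> V)).
  by apply/ex_bound; exists 0; near=> x => /=; rewrite normr0.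
have K0 : 0 <= K.
  have [v v0] : exists v, f v != 0.
    by apply: contrapT => h; move/eqP: nz; apply; apply/funext => v;
      apply/eqP/negPn/negP => v0; apply: h; exists v.
  have n0 : 0 < `|v|.
    by rewrite normr_gt0; apply: contraNN v0 => /eqP ->; rewrite raddf0.
  by rewrite -(pmulr_lge0 _ n0); exact: le_trans (hT v).
apply/linear_boundedP; exists K; split; first exact: ger0_real.
by move=> r /ltW Kr v; rewrite (le_trans (hT v))// ler_wpM2r.
Unshelve. all: by end_near. Qed.

End Approximation.

(** * Bounded operators and Riesz representation *)

Section Operators.
Variables (R : realType) (H : completeNormedModType R[i]).
Implicit Types T : H -> H.

Lemma bop_lin T : bounded_operator T ->
  forall c u v, T (c *: u + v) = c *: T u + T v.
Proof. by case=> lT _ c u v; rewrite lT. Qed.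

Lemma bop0 T : bounded_operator T -> T 0 = 0.
Proof. by move=> /bop_lin/(_ (-1) 0 0); rewrite !scaleN1r !addNr. Qed.

Lemma bopZ T : bounded_operator T -> forall c u, T (c *: u) = c *: T u.
Proof.
by move=> bT c u; have := bop_lin bT c u 0; rewrite (bop0 bT) !addr0.
Qed.

Lemma bopD T : bounded_operator T -> forall u v, T (u + v) = T u + T v.
Proof. by move=> bT u v; have := bop_lin bT 1 u v; rewrite !scale1r. Qed.

Lemma bopB T : bounded_operator T -> forall u v, T (u - v) = T u - T v.
Proof.
by move=> bT u v; rewrite (bopD bT) -scaleN1r (bopZ bT) scaleN1r.
Qed.

Lemma bounded_operator_comp T1 T2 : bounded_operator T1 -> bounded_operator T2 ->
  bounded_operator (T1 \o T2).
Proof.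
move=> b1 b2; have [K1 K10 h1] := bounded_operator_bound b1.
have [K2 K20 h2] := bounded_operator_bound b2.
apply: (@bound_bounded_operator _ _ _ (K1 * K2)) => [c u v|v] /=.
  by rewrite (bop_lin b2) (bop_lin b1).
by rewrite (le_trans (h1 _))// -mulrA ler_wpM2l// ltW.
Qed.

Lemma bounded_operator_lin (c : R[i]) T1 T2 :
  bounded_operator T1 -> bounded_operator T2 ->
  bounded_operator (fun v => c *: T1 v + T2 v).
Proof.
move=> b1 b2; have [K1 K10 h1] := bounded_operator_bound b1.
have [K2 K20 h2] := bounded_operator_bound b2.
apply: (@bound_bounded_operator _ _ _ (`|c| * K1 + K2)) => [a u v|v] /=.
  rewrite (bop_lin b2) (bop_lin b1) !scalerDr !scalerA [c * a]mulrC -!addrA; congr (_ + _).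
  by rewrite addrCA.
rewrite (le_trans (ler_normD _ _))// mulrDl normrZ lerD//.
by rewrite -mulrA ler_wpM2l.
Qed.

End Operators.

Section Riesz.
Variables (R : realType) (H : completeNormedModType R[i]).
Variable ip : {dot H for @Num.conj R[i]}.
Hypothesis hilb : hilbert_norm ip.
Implicit Types u v w : H.

Let nr v : R := complex.Re `|v|.
Let g u v : R := complex.Re (ip u v).
Let q v : R := g v v.

Let ReD (a b : R[i]) : complex.Re (a + b) = complex.Re a + complex.Re b.
Proof. by case: a => ? ?; case: b. Qed.

Let ReZ (t : R) (a : R[i]) : complex.Re (t%:C * a) = t * complex.Re a.
Proof. by case: a => a b /=; rewrite mul0r subr0. Qed.

Let nr_ge0 v : 0 <= nr v.
Proof. by rewrite -ler0c Re_norm. Qed.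

Let qE v : q v = nr v ^+ 2.
Proof.
apply: complexI; rewrite rmorphXn/= Re_norm -hilb [LHS]RRe_real//.
by rewrite hilb rpredX// normr_real.
Qed.

Let gC u v : g u v = g v u.
Proof. by rewrite /g (ipC ip u); case: (ip v u). Qed.

Let gDl u v w : g (u + v) w = g u w + g v w.
Proof. by rewrite /g ipDl ReD. Qed.

Let gZl t u w : g (t%:C *: u) w = t * g u w.
Proof. by rewrite /g ipZl ReZ. Qed.

Let qD t u w : q (u + t%:C *: w) = q u + 2 * t * g w u + t ^+ 2 * q w.
Proof.
rewrite /q gDl gZl (gC u) (gC w (_ + _)) !gDl !gZl (gC u w); ring.
Qed.

Let g_le u v : `|g u v| <= nr u * nr v.
Proof.
rewrite -lecR (le_trans (Re_le_norm _))// (le_trans (cauchy_schwarz hilb u v))//.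
by rewrite rmorphM/= !Re_norm.
Qed.

(** A bounded functional is represented by the minimiser of
    [|v|^2 - 2 Re (f v)]: the parallelogram identity makes minimising sequences
    Cauchy, and the first variation at the minimiser [l] in the direction [w]
    vanishes exactly when [Re (ip w l) = Re (f w)]. *)
Lemma riesz (f : H -> R[i]) (K : R) :
  (forall c u v, f (c *: u + v) = c * f u + f v) ->
  (forall v, `|f v| <= K%:C * `|v|) -> exists l, forall v, f v = ip v l.
Proof.
move=> flin fK.
pose F v := complex.Re (f v).
have FD t u w : F (u + t%:C *: w) = F u + t * F w.
  by rewrite /F addrC flin ReD ReZ addrC.
have FK v : `|F v| <= K * nr v.
  by rewrite -lecR (le_trans (Re_le_norm _))// rmorphM/= Re_norm.
pose J v := q v - 2 * F v.
have J_ge v : - K ^+ 2 <= J v.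
  have := FK v; rewrite ler_norml => /andP[_ h].
  rewrite /J qE; have := sqr_ge0 (nr v - K); nra.
have hinf : has_inf (range J).
  by split; [exists (J 0); exists 0|exists (- K ^+ 2) => _ [v _ <-]].
pose m := inf (range J).
have m_le v : m <= J v by apply: ge_inf; [case: hinf|exists v].
have adh n : exists v, J v < m + n.+1%:R^-1.
  have [_ [v _ <-] hv] := @inf_adherent _ (range J) n.+1%:R^-1
    ltac:(by rewrite invr_gt0) hinf.
  by exists v.
have [x hx] := choice adh.
(* The parallelogram identity, at the midpoint of [u] and [v]. *)
have JB u v : q (u - v) = 2 * J u + 2 * J v - 4 * J (2^-1%:C *: u + 2^-1%:C *: v).
  have e1 := qD (-1) u v; have e2 := qD 2^-1 (2^-1%:C *: u) v.
  have e3 := FD 2^-1 (2^-1%:C *: u) v; have e4 := FD 2^-1 0 u.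
  have e5 := qD 2^-1 0 u.
  have f0 : F 0 = 0 by have := FD (-1) 0 0; rewrite scaler0 addr0 => ?; lra.
  have g0 w : g w 0 = 0 by rewrite /g ip0r.
  rewrite rmorphN rmorph1 scaleN1r in e1.
  rewrite add0r f0 in e4; rewrite add0r g0 /q g0 in e5.
  have e6 := gZl 2^-1 u v; rewrite gC in e6.
  rewrite /J e1 e2 e3 e4 /q e5 e6 [g u v]gC; nra.
have xC m' n : q (x m' - x n) <= 2 * (m'.+1%:R^-1 + n.+1%:R^-1).
  rewrite JB; have := hx m'; have := hx n.
  move: (m_le (2^-1%:C *: x m' + 2^-1%:C *: x n)).
  move: (_^-1) (_^-1) (J _) (J _) (J _) => a b c d e; lra.
have inv_small (e : R) : 0 < e -> exists N : nat, forall n, (N <= n)%N -> n.+1%:R^-1 <= e.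
  move=> e0; have [N _ hN] := near_infty_natSinv_lt (PosNum e0).
  by exists N => n /hN /ltW.
have [l hl] : exists l, forall e : R[i], 0 < e -> exists N : nat,
    forall n, (N <= n)%N -> `|x n - l| <= e.
  apply: cauchy_limit => _ /ltC0P[e e0 ->].
  have [|N hN] := inv_small (e ^+ 2 / 4); first by rewrite divr_gt0// exprn_gt0.
  exists N => i j Ni Nj; rewrite -Re_norm lecR -/(nr _) -ler_sqr ?nnegrE ?(ltW e0) ?nr_ge0//.
  rewrite -qE; move: (xC i j) (hN _ Ni) (hN _ Nj).
  by move: (q _) (i.+1%:R^-1) (j.+1%:R^-1) => a b c; lra.
(* [J] nearly attains its infimum at [x n], so that its first variation there in
   the directions [w] and [- w] is nearly nonnegative. *)
have main w : g w l = F w.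
  apply/eqP; rewrite -subr_eq0; apply/eqP.
  apply: (@eq0_small _ _ _ ((q w + 1) / 2 + nr w)).
    by rewrite addr_ge0// divr_ge0// addr_ge0// qE exprn_ge0.
  move=> d d0.
  have [|N hN] := inv_small (d ^+ 2); first by rewrite exprn_gt0.
  have [|N' hN'] := hl d%:C; first by rewrite ltcR.
  pose n := maxn N N'.
  have h1 : J (x n) <= m + d ^+ 2.
    rewrite ltW// (lt_le_trans (hx n))// lerD2l hN//.
    by rewrite leq_maxl.
  have h2 : nr (x n - l) <= d by rewrite -lecR Re_norm hN'// leq_maxr.
  have h3 := m_le (x n + d%:C *: w); have h4 := m_le (x n + (- d)%:C *: w).
  rewrite /J !FD !qD in h3 h4 h1.
  have h5 : d * (g w (x n) - F w) <= d * (d * (q w + 1) / 2) by nra.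
  have h6 : d * (- (g w (x n) - F w)) <= d * (d * (q w + 1) / 2) by nra.
  rewrite !ler_pM2l// in h5 h6.
  have h7 : `|g w (x n - l)| <= nr w * d.
    by rewrite (le_trans (g_le _ _))// ler_wpM2l.
  have : g w (x n - l) = g w (x n) - g w l.
    by rewrite /g ipBr; case: (ip w (x n)) => ? ?; case: (ip w l).
  move: h7; rewrite ler_norml ler_norml => /andP[h7 h7'] h8; apply/andP; split; nra.
exists l => v; have hr : complex.Re (f v) = complex.Re (ip v l) by rewrite -/(F v) -main.
(* The imaginary parts agree by [main] at ['i *: v]. *)
have hi : complex.Re ('i%C * f v) = complex.Re ('i%C * ip v l).
  rewrite -ipZl -/(g _ _) main /F -[in RHS](addr0 ('i%C *: v)) flin.
  have -> : f 0 = 0 by have := flin (-1) 0 0; rewrite scaleN1r oppr0 addr0 mulN1r addNr.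
  by rewrite addr0.
by move: hr hi; case: (f v) => a b; case: (ip v l) => c d /= ->;
  rewrite !mul0r !mul1r !sub0r => /oppr_inj ->.
Qed.

(** [T*] is obtained from [riesz] applied to [v |-> ip (T v) w]. *)
Lemma adjoint_exists (T : H -> H) : bounded_operator T ->
  exists2 S, bounded_operator S & adjoint_pair ip T S.
Proof.
move=> bT; have [_ /ltC0P[K K0 ->] hK] := bounded_operator_bound bT.
have /choice[S hS] w : exists l, forall v, ip (T v) w = ip v l.
  apply: (@riesz _ (K * nr w)) => [c u v|v].
    by rewrite (bop_lin bT) ipDl ipZl.
  rewrite (le_trans (cauchy_schwarz hilb _ _))// rmorphM/= Re_norm mulrAC.
  by rewrite ler_wpM2r.
exists S; last by move=> v w; exact: hS.
apply: (@bound_bounded_operator _ _ _ K%:C) => [c u v|v].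
  by apply: (@dot_inj _ _ ip) => w; rewrite ipDr ipZr -!hS ipDr ipZr.
have [->|Sv0] := eqVneq (S v) 0; first by rewrite normr0 mulr_ge0// ler0c ltW.
have n0 : 0 < `|S v| by rewrite normr_gt0.
rewrite -(ler_pM2r n0) -expr2 -hilb -hS.
rewrite (@le_trans _ _ `|ip (T (S v)) v|)//.
  by rewrite hS hilb ger0_norm// exprn_ge0.
rewrite (le_trans (cauchy_schwarz hilb _ _))// mulrAC ler_wpM2r//.
Qed.

End Riesz.

(** * Double commutants *)

Section DoubleCommutant.
Variables (R : realType) (H : completeNormedModType R[i]).
Variable ip : {dot H for @Num.conj R[i]}.
Hypothesis hilb : hilbert_norm ip.
Implicit Types (S : set (H -> H)) (x y T : H -> H).

Lemma adjoint_pair_sym x y : adjoint_pair ip x y -> adjoint_pair ip y x.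
Proof. by move=> h u v; rewrite ipC -h -ipC. Qed.

Lemma commutantE S T x : commutant S T -> S x -> forall v, T (x v) = x (T v).
Proof. by move=> [_ h] /h e v; have := congr1 (fun f => f v) e. Qed.

Lemma commutant_anti S1 S2 : S1 `<=` S2 -> commutant S2 `<=` commutant S1.
Proof. by move=> h T [bT hT]; split=> // x /h/hT. Qed.

Lemma sub_double_commutant S : S `<=` bounded_operator (H := H) ->
  S `<=` commutant (commutant S).
Proof. by move=> h x Sx; split; [exact: h|move=> y [_ ->]]. Qed.

Lemma commutant_bounded S : commutant S `<=` bounded_operator (H := H).
Proof. by move=> x []. Qed.

Lemma triple_commutant S : S `<=` bounded_operator (H := H) ->
  commutant (commutant (commutant S)) = commutant S.
Proof.
move=> h; apply/seteqP; split; first exact/commutant_anti/sub_double_commutant.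
exact/sub_double_commutant/commutant_bounded.
Qed.

Lemma commutant_lin S (c : R[i]) T1 T2 : S `<=` bounded_operator (H := H) ->
  commutant S T1 -> commutant S T2 -> commutant S (fun v => c *: T1 v + T2 v).
Proof.
move=> h h1 h2; split; first by apply: bounded_operator_lin; [case: h1|case: h2].
move=> x Sx; apply/funext => v /=.
by rewrite (bop_lin (h _ Sx)) (commutantE h1)// (commutantE h2).
Qed.

Lemma commutant_comp S T1 T2 :
  commutant S T1 -> commutant S T2 -> commutant S (T1 \o T2).
Proof.
move=> h1 h2; split; first by apply: bounded_operator_comp; [case: h1|case: h2].
by move=> x Sx; apply/funext => v /=; rewrite (commutantE h2)// (commutantE h1).
Qed.

Definition adjoint_closed S := forall x, S x -> exists2 y, S y & adjoint_pair ip x y.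

(** If [T] commutes with [x] and [x^*], then [T^*] commutes with [x]. *)
Lemma commutant_adjoint_closed S : adjoint_closed S -> adjoint_closed (commutant S).
Proof.
move=> hS T hT; have [U bU hU] := adjoint_exists hilb hT.1.
exists U => //; split=> // x Sx; have [y Sy /adjoint_pair_sym xy] := hS _ Sx.
apply/funext => v /=; apply: (@dot_inj _ _ ip) => w.
by rewrite -hU -xy -(commutantE hT)// hU xy.
Qed.

Lemma double_commutant_vn S : S `<=` bounded_operator (H := H) ->
  adjoint_closed S -> von_neumann_algebra ip (commutant (commutant S)).
Proof.
move=> bS aS; split; first by do 2 apply: commutant_adjoint_closed.
by rewrite triple_commutant//; exact: commutant_bounded.
Qed.

(** The double commutant is a von Neumann algebra because adjoints exist, and
    lies in every von Neumann algebra that contains [S] because such an algebra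
    equals its double commutant. *)
Lemma vn_generated_double_commutant S : S `<=` bounded_operator (H := H) ->
  adjoint_closed S -> vn_generated ip S = commutant (commutant S).
Proof.
move=> bS aS; apply/seteqP; split=> [x|x hx M [[_ MM] SM]].
  apply; split; first exact: double_commutant_vn.
  exact: sub_double_commutant.
by rewrite -MM; apply: commutant_anti hx; exact: commutant_anti.
Qed.

End DoubleCommutant.

Section LipschitzExtension.
Variables (R : realType) (H : completeNormedModType R[i]).

(** The unique continuous extension of the correspondence [f i |-> g i],
    characterised by the estimate it satisfies with respect to all the [f i]. *)
Lemma lipschitz_extension (I : Type) (f g : I -> H) (K : R[i]) : 0 < K ->
  closure (range f) = setT -> (forall i j, `|g i - g j| <= K * `|f i - f j|) ->
  exists G : H -> H, forall i v, `|g i - G v| <= K * `|f i - v|.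
Proof.
move=> K0 df fg.
suff /choice[G hG] v : exists l, forall i, `|g i - l| <= K * `|f i - v|.
  by exists G.
have /choice[s hs] (n : nat) : exists i, `|v - f i| <= n.+1%:R^-1.
  have [|_ [i _ <-] hi] := closure_approx df v (e := n.+1%:R^-1).
    by rewrite invr_gt0.
  by exists i.
have [l hl] : exists l, forall e : R[i], 0 < e -> exists N : nat,
    forall n, (N <= n)%N -> `|g (s n) - l| <= e.
  apply: cauchy_limit => e e0.
  have [|N hN] := invn_small (e := e / (K * 2)); first by rewrite divr_gt0// mulr_gt0.
  exists N => m n Nm Nn; rewrite (le_trans (fg _ _))// -ler_pdivlMl//.
  rewrite (le_trans (ler_distD v _ _))// distrC.
  rewrite (le_trans (lerD (hs m) (hs n)))// (le_trans (lerD (hN _ Nm) (hN _ Nn)))//.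
  by rewrite -mulr2n -[_ *+ 2]mulr_natr invfM mulrA divfK ?pnatr_eq0// mulrC.
exists l => i; rewrite -subr_le0.
apply/ler_addgt0Pr => e e0; rewrite add0r lerBlDr.
have e2 : 0 < e / 2 by rewrite divr_gt0.
have [N hN] := hl _ e2.
have [|N' hN'] := invn_small (e := e / 2 / K); first by rewrite divr_gt0.
pose n := maxn N N'.
rewrite (le_trans (ler_distD (g (s n)) _ _))//.
rewrite [leRHS](_ : _ = K * (`|f i - v| + e / 2 / K) + e / 2); last first.
  by rewrite mulrDr [K * (_ / K)]mulrC divfK ?gt_eqF// addrC -addrA [e in LHS]splitr.
rewrite lerD//; last by rewrite hN// leq_maxl.
rewrite (le_trans (fg _ _))// ler_pM2l// (le_trans (ler_distD v _ _))// lerD2l.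
by rewrite (le_trans (hs _))// hN'// leq_maxr.
Qed.

End LipschitzExtension.

(** * The GNS representation of a tracial state *)

Section TracialGNS.
Variables (R : realType) (A : completeNormedModType R[i]) (cs : cstar A).
Variable rho : A -> R[i].
Variables (H : completeNormedModType R[i]) (ip : {dot H for @Num.conj R[i]}).
Variables (pi : A -> H -> H) (Omega : H).
Hypothesis hrho : is_state cs rho.
Hypothesis tracial : forall a b, rho (cmul cs a b) = rho (cmul cs b a).
Hypothesis hpi : is_gns cs rho ip pi Omega.

Let hilb : hilbert_norm ip := gns_hilbert hpi.
Let bpi a : bounded_operator (pi a) := gns_bounded hpi a.
Local Notation "a ** b" := (cmul cs a b) (at level 40, left associativity).
Local Notation "a ^#" := (cadj cs a) (at level 2, format "a ^#").
Local Notation vec a := (pi a Omega).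
Local Notation N := (commutant (commutant (range pi))).

Lemma pi_comp a b v : pi (a ** b) v = pi a (pi b v).
Proof. by have := congr1 (fun f => f v) (gns_mul hpi a b). Qed.

Lemma vec_approx v (e : R[i]) : 0 < e -> exists a, `|v - vec a| <= e.
Proof. by move=> /(closure_approx (gns_cyclic hpi) v)[_ [a _ <-] h]; exists a. Qed.

Lemma eq_on_vec T1 T2 : bounded_operator T1 -> bounded_operator T2 ->
  (forall a, T1 (vec a) = T2 (vec a)) -> T1 = T2.
Proof.
move=> b1 b2 h; apply/funext => v; apply/eqP; rewrite -subr_eq0; apply/eqP.
have [K1 K10 h1] := bounded_operator_bound b1.
have [K2 K20 h2] := bounded_operator_bound b2.
apply: (@eq0_small _ _ _ (K1 + K2)) => [|e e0]; first by rewrite addr_ge0// ltW.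
have [a ha] := vec_approx v e0.
rewrite [leLHS](_ : _ = `|T1 (v - vec a) - T2 (v - vec a)|); last first.
  by rewrite (bopB b1) (bopB b2) h; congr (`|_|); rewrite opprB addrA subrK.
rewrite (le_trans (ler_normB _ _))// mulrDl lerD//.
  by rewrite (le_trans (h1 _))// ler_pM2l.
by rewrite (le_trans (h2 _))// ler_pM2l.
Qed.

Lemma pi_one v : pi (cone cs) v = v.
Proof.
have -> // : pi (cone cs) = id.
apply: eq_on_vec => //; first by split => // x; exact: cvg_id.
by move=> a; rewrite -pi_comp cmul1l.
Qed.

Lemma pi_adjr a u v : ip u (pi a v) = ip (pi a^# u) v.
Proof. by rewrite (gns_adj hpi) cadjK. Qed.

Lemma ip_vec a b : ip (vec a) (vec b) = rho (b^# ** a).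
Proof. by rewrite pi_adjr -pi_comp (gns_state hpi). Qed.

Lemma norm_vec a : `|vec a| ^+ 2 = rho (a^# ** a).
Proof. by rewrite -hilb ip_vec. Qed.

(** Traciality makes the involution isometric for the norm of the GNS space. *)
Lemma norm_vec_adj a : `|vec a^#| = `|vec a|.
Proof.
apply/eqP; rewrite -(@eqrXn2 _ 2)// !norm_vec cadjK.
by rewrite tracial.
Qed.

Lemma norm_Omega : `|Omega| = 1.
Proof.
apply/eqP; rewrite -(@eqrXn2 _ 2)// -hilb expr1n; apply/eqP.
by rewrite -[X in ip X _]pi_one -(gns_state hpi) (state_one hrho).
Qed.

Lemma norm_vec_le a : `|vec a| <= `|a|.
Proof.
rewrite -ler_sqr ?nnegrE// norm_vec -(cnorm_cstar cs).
by rewrite (le_trans _ (state_bounded hrho _))// ger0_norm ?(state_ge0 hrho).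
Qed.

Lemma vec_lin c a b : vec (c *: a + b) = c *: vec a + vec b.
Proof. exact: (gns_linear hpi). Qed.

Lemma vecB a b : vec (a - b) = vec a - vec b.
Proof. by rewrite addrC -scaleN1r vec_lin scaleN1r addrC. Qed.

Lemma vec0 : vec 0 = 0.
Proof. by have := vecB 0 0; rewrite !subrr. Qed.

Lemma cmulBl a b c : (a - b) ** c = a ** c - b ** c.
Proof. by rewrite addrC -scaleN1r cmul_linearl scaleN1r addrC. Qed.

Lemma cmul0l c : 0 ** c = 0.
Proof. by have := cmulBl 0 0 c; rewrite !subrr. Qed.

(** Traciality makes right multiplication by [b] bounded on the dense subspace
    of the [pi a Omega]. *)
Lemma right_multiplication b : exists2 G, commutant (range pi) G &
  forall a, G (vec a) = vec (a ** b).
Proof.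
have [K K0 hK] := bounded_operator_bound (bpi b^#).
have bnd a : `|vec (a ** b)| <= K * `|vec a|.
  rewrite -norm_vec_adj cadjM pi_comp (le_trans (hK _))//.
  by rewrite norm_vec_adj.
have [|G hG] := lipschitz_extension (f := fun a => vec a)
    (g := fun a => vec (a ** b)) K0 (gns_cyclic hpi).
  by move=> a a'; rewrite -!vecB -cmulBl.
have Gvec a : G (vec a) = vec (a ** b).
  have := hG a (vec a); rewrite subrr normr0 mulr0 normr_le0 subr_eq0.
  by move/eqP.
have Glin : linear G.
  move=> c u v; apply/eqP; rewrite -subr_eq0; apply/eqP.
  apply: (@eq0_small _ _ _ (2 * (K * (`|c| + 1)))) => [|e e0].
    by rewrite !mulr_ge0// ?addr_ge0// ltW.
  have [a ha] := vec_approx u e0; have [a' ha'] := vec_approx v e0.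
  have h1 := hG (c *: a + a') (c *: u + v).
  have h2 := hG a u; have h3 := hG a' v.
  rewrite (le_trans (ler_distD (vec ((c *: a + a') ** b)) _ _))//.
  rewrite -mulrA mulr_natl mulr2n lerD//.
    rewrite distrC (le_trans h1)// -mulrA ler_pM2l// vec_lin opprD addrACA -scalerBr.
    rewrite (le_trans (ler_normD _ _))// mulrDl mul1r lerD//; last by rewrite distrC.
    by rewrite normrZ ler_wpM2l// distrC.
  rewrite cmul_linearl vec_lin opprD addrACA -scalerBr.
  rewrite (le_trans (ler_normD _ _))// mulrDr mulr1 mulrDl lerD//.
    rewrite normrZ [K * _]mulrC -mulrA ler_wpM2l// (le_trans h2)// ler_pM2l//.
    by rewrite distrC.
  by rewrite (le_trans h3)// ler_pM2l// distrC.
have bG : bounded_operator G.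
  apply: (@bound_bounded_operator _ _ _ K) => // v.
  by have := hG 0 v; rewrite cmul0l vec0 !sub0r !normrN.
exists G => //; split => // _ [c _ <-].
apply: eq_on_vec; try exact: bounded_operator_comp.
by move=> a /=; rewrite Gvec -!pi_comp Gvec cmulA.
Qed.

(** [Omega] is cyclic for the right multiplications, which lie in the commutant. *)
Lemma Omega_separating x y : N x -> N y -> x Omega = y Omega -> x = y.
Proof.
move=> Nx Ny xy; apply: eq_on_vec; [by case: Nx|by case: Ny|] => b.
have [G hG Gv] := right_multiplication b.
have <- : G Omega = vec b by rewrite -[in LHS](pi_one Omega) Gv cmul1l.
by rewrite (commutantE Nx)// xy (commutantE Ny).
Qed.

Lemma eq_dot_vec u v : (forall a, ip u (vec a) = ip v (vec a)) -> u = v.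
Proof.
move=> h; apply/eqP; rewrite -subr_eq0; apply/eqP.
apply: (@eq0_small _ _ _ 1) => // e e0; set w := u - v.
have [a ha] := vec_approx w e0.
have [->|w0] := eqVneq w 0; first by rewrite normr0 mul1r ltW.
have n0 : 0 < `|w| by rewrite normr_gt0.
rewrite mul1r -(ler_pM2l n0) -expr2 -[leLHS]ger0_norm ?exprn_ge0// -hilb.
have hw : ip w (vec a) = 0 by rewrite /w ipBl h subrr.
have -> : ip w w = ip w (w - vec a) by rewrite [RHS]ipBr hw subr0.
by rewrite (le_trans (cauchy_schwarz hilb _ _))// ler_pM2l.
Qed.

(** The adjoint of right multiplication by [b] is right multiplication by
    [b^*], which sends [Omega] to [pi b^* Omega]. *)
Lemma vec_adjoint x S b : N x -> adjoint_pair ip x S ->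
  ip (S Omega) (vec b) = ip (vec b^#) (x Omega).
Proof.
move=> Nx xS; have [G hG Gv] := right_multiplication b.
have [U bU hU] := adjoint_exists hilb hG.1.
have <- : U Omega = vec b^#.
  apply: eq_dot_vec => a; rewrite (adjoint_pair_sym hU) Gv.
  by rewrite [RHS]ip_vec [LHS]pi_adjr -(gns_state hpi) cadjM tracial.
have <- : G Omega = vec b by rewrite -[in LHS](pi_one Omega) Gv cmul1l.
rewrite (adjoint_pair_sym xS) (commutantE Nx)//.
by rewrite (adjoint_pair_sym hU).
Qed.

Lemma norm_le_vec u (M : R[i]) : 0 <= M ->
  (forall a, `|ip u (vec a)| <= `|vec a| * M) -> `|u| <= M.
Proof.
move=> M0 h; have [->|u0] := eqVneq u 0; first by rewrite normr0.
have n0 : 0 < `|u| by rewrite normr_gt0.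
apply/ler_addgt0Pr => e e0; rewrite -(ler_pM2l n0).
have d0 : 0 < `|u| * e / (`|u| + M) by rewrite divr_gt0 ?mulr_gt0// ltr_wpDr.
have [a ha] := vec_approx u d0.
rewrite -expr2 -[leLHS]ger0_norm ?exprn_ge0// -hilb -{2}(subrK (vec a) u) ipDr.
rewrite (le_trans (ler_normD _ _))//.
rewrite (le_trans (lerD (cauchy_schwarz hilb _ _) (h a)))//.
have hva : `|vec a| <= `|u| + `|u - vec a|.
  by rewrite -{1}(subKr u (vec a)) (le_trans (ler_normB _ _)).
rewrite (@le_trans _ _ (`|u| * `|u - vec a| + (`|u| + `|u - vec a|) * M))//.
  by rewrite lerD2l ler_wpM2r.
rewrite mulrDl addrCA mulrDr lerD2l mulrC -mulrDr [leLHS]mulrC.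
by rewrite -ler_pdivlMl ?ltr_wpDr// mulrC.
Qed.

(** The involution stays isometric on the double commutant: pairing with
    [vec a], [vec_adjoint] moves the adjoint to [a]. *)
Lemma norm_adjoint_vec x S : N x -> adjoint_pair ip x S ->
  `|S Omega| <= `|x Omega|.
Proof.
move=> Nx xS; apply: norm_le_vec => // a; rewrite (vec_adjoint _ Nx xS).
by rewrite (le_trans (cauchy_schwarz hilb _ _))// norm_vec_adj.
Qed.

(** Both sides are read off approximations [b] of [y], for which the adjoint
    is approximated as well as [y] itself. *)
Lemma double_commutant_tracial x y : N x -> N y ->
  ip (y (x Omega)) Omega = ip (x (y Omega)) Omega.
Proof.
move=> Nx Ny.
have [S bS xS] := adjoint_exists hilb Nx.1.
have [T bT yT] := adjoint_exists hilb Ny.1.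
rewrite [LHS]yT [RHS]xS; apply/eqP; rewrite -subr_eq0; apply/eqP.
apply: (@eq0_small _ _ _ (`|x Omega| + `|S Omega|)); first by rewrite addr_ge0.
move=> e e0; have [b hb] := vec_approx (y Omega) e0.
(* [T - pi b^#] is the adjoint of [y - pi b]. *)
have hb' : `|T Omega - vec b^#| <= e.
  apply: le_trans hb.
  have Nb : N (pi b) by apply: sub_double_commutant => [_ [a _ <-]|]; [exact: bpi|exists b].
  have Nyb : N (fun v => (-1) *: pi b v + y v).
    by apply: commutant_lin => //; exact: commutant_bounded.
  have := @norm_adjoint_vec _ (fun v => (-1) *: pi b^# v + T v) Nyb.
  rewrite !scaleN1r ![- _ + _]addrC; apply=> u v.
  by rewrite ipDl ipZl ipDr ipZr (gns_adj hpi) yT rmorphN rmorph1.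
have eb : ip (vec b) (S Omega) = ip (x Omega) (vec b^#).
  by rewrite ipC (vec_adjoint _ Nx xS) -ipC.
have -> : ip (x Omega) (T Omega) - ip (y Omega) (S Omega) =
    ip (x Omega) (T Omega - vec b^#) - ip (y Omega - vec b) (S Omega).
  by rewrite ipBr ipBl eb opprB addrA subrK.
rewrite (le_trans (ler_normB _ _))// mulrDl lerD//.
  by rewrite (le_trans (cauchy_schwarz hilb _ _))// ler_wpM2l.
by rewrite (le_trans (cauchy_schwarz hilb _ _))// mulrC ler_wpM2l.
Qed.

End TracialGNS.

(** * The shell enumeration *)

Section ShellEnumeration.

Lemma shellE a b : shell a.+1 b.+1 =
  if (a <= b)%N then (b * b + a).+1 else (a * a + 2 * a - b).+1.
Proof.
rewrite /shell ltnS; case: leqP => ab; first by rewrite subn1 /= -mulnn addnS.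
rewrite -mulnn mulSn mulnS; lia.
Qed.

Lemma shell_gt0 a b : (0 < shell a.+1 b.+1)%N.
Proof. by rewrite shellE; case: ifP. Qed.

(** The shells are the sets of positions with a given maximum of the
    coordinates. *)
Lemma shell_max a b :
  (maxn a b * maxn a b < shell a.+1 b.+1 <= (maxn a b).+1 * (maxn a b).+1)%N.
Proof.
by rewrite shellE; case: (leqP a b) => h; nia.
Qed.

(** The value determines the shell by [shell_max], and a position within it. *)
Lemma shell_inj a b c d : shell a.+1 b.+1 = shell c.+1 d.+1 -> a = c /\ b = d.
Proof.
move=> e; have /andP[h1 h2] := shell_max a b; have /andP[h3 h4] := shell_max c d.
have hm : maxn a b = maxn c d.
  have : (maxn a b < (maxn c d).+1)%N by rewrite -ltn_sqr -!mulnn; lia.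
  have : (maxn c d < (maxn a b).+1)%N by rewrite -ltn_sqr -!mulnn; lia.
  lia.
move: e hm {h1 h2 h3 h4}; rewrite !shellE /maxn.
by case: (leqP a b) => h; case: (leqP c d) => h' e;
  case: ltnP => h1; case: ltnP => h2 hm; nia.
Qed.

Lemma shell_le N a b : (a < N)%N -> (b < N)%N -> (shell a.+1 b.+1 <= N * N)%N.
Proof.
move=> aN bN; have /andP[_] := shell_max a b; move/leq_trans; apply.
by rewrite leq_mul// gtn_max aN bN.
Qed.

Lemma shell_surj N m : (m < N * N)%N ->
  exists a b, [/\ (a < N)%N, (b < N)%N & shell a.+1 b.+1 = m.+1].
Proof.
elim: N => [//|N IH] mN; have [/IH[a [b [? ? ?]]]|Nm] := ltnP m (N * N).
  by exists a, b; split=> //; lia.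
have [h|h] := leqP (m - N * N) N.
  by exists (m - N * N)%N, N; split => //; rewrite shellE h; lia.
exists N, (N * N + 2 * N - m)%N; split => //; first lia.
rewrite shellE; case: (leqP N) => h'; lia.
Qed.

(** The first [k] positions of the enumeration: a square corner, and two
    segments in the column and in the row of the current shell. *)
Lemma shell_corner k : exists M, forall a b,
  (shell a.+1 b.+1 <= k)%N =
  [|| (a < M)%N && (b < M)%N,
      (M * M + a < k)%N && (a <= M)%N && (b == M) |
      (a == M) && ((b < M) && (M * M + 2 * M - b < k))%N].
Proof.
have [M /andP[Mk kM]] : exists M, (M * M <= k < M.+1 * M.+1)%N.
  elim: k => [|k [M /andP[h1 h2]]]; first by exists 0%N.
  have [h|h] := ltnP k.+1 (M.+1 * M.+1); first by exists M; lia.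
  by exists M.+1; lia.
exists M => a b; apply/idP/idP.
  move=> h; have /andP[h1 _] := shell_max a b.
  have hM : (maxn a b < M.+1)%N by rewrite -ltn_sqr -!mulnn; lia.
  have [aM bM] : (a <= M)%N /\ (b <= M)%N by lia.
  have [aE|aE] : a = M \/ (a < M)%N by lia.
    by subst a; move: h; rewrite shellE; case: (leqP M b) => ab h;
      [have bE : b = M by lia|]; subst; lia.
  have [bE|bE] : b = M \/ (b < M)%N by lia.
    by subst b; move: h; rewrite shellE (ltnW aE); lia.
  by rewrite aE bE.
case/or3P => [/andP[aM bM]|/andP[/andP[h1 h2] /eqP h3]|/and3P[/eqP h1 h2 h3]].
- exact: leq_trans (shell_le aM bM) Mk.
- by subst b; rewrite shellE h2.
- by subst a; rewrite shellE (leqNgt M b) h2.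
Qed.

End ShellEnumeration.

(** * Kronecker products and slices *)

Section HaarMatrices.
Variable R : realType.
Local Notation C := R[i].

Definition madj m (x : 'M[C]_m) : 'M[C]_m := map_mx Num.conj x^T.

Lemma madjE m (x : 'M[C]_m) i j : madj x i j = (x j i)^*.
Proof. by rewrite !mxE. Qed.

Lemma madjK m : involutive (@madj m).
Proof. by move=> x; apply/matrixP => i j; rewrite !madjE conjCK. Qed.

Lemma tr_mulE m (x y : 'M[C]_m) : \tr (x *m y) = \sum_i \sum_j x i j * y j i.
Proof. by apply: eq_bigr => i _; rewrite mxE. Qed.

(** Index of the [p]-th row in the [i]-th block row of a Kronecker product. *)
Definition kidx n (i : 'I_(2 ^ n.+1)) (p : 'I_2) : 'I_(2 ^ n.+2) :=
  cast_ord (esym (expnSr 2 n.+1)) (mxtens_index (i, p)).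

Definition kidx_inv n (k : 'I_(2 ^ n.+2)) : 'I_(2 ^ n.+1) * 'I_2 :=
  mxtens_unindex (cast_ord (expnSr 2 n.+1) k).

Lemma kidxK n i p : kidx_inv (@kidx n i p) = (i, p).
Proof. by rewrite /kidx_inv /kidx cast_ordKV mxtens_indexK. Qed.

Lemma kidx_invK n (k : 'I_(2 ^ n.+2)) : kidx (kidx_inv k).1 (kidx_inv k).2 = k.
Proof.
by rewrite /kidx -surjective_pairing mxtens_unindexK cast_ordK.
Qed.

Lemma sum_kidx (V : nmodType) n (F : 'I_(2 ^ n.+2) -> V) :
  \sum_k F k = \sum_i \sum_p F (kidx i p).
Proof.
rewrite pair_big /= (reindex (fun ip => kidx ip.1 ip.2)) //=.
exists (@kidx_inv n) => [[i p] _|k _]; [exact: kidxK|exact: kidx_invK].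
Qed.

Lemma kidx_matrixP n (x y : 'M[C]_(2 ^ n.+2)) :
  (forall i p j q, x (kidx i p) (kidx j q) = y (kidx i p) (kidx j q)) -> x = y.
Proof.
move=> h; apply/matrixP => k l; rewrite -(kidx_invK k) -(kidx_invK l); exact: h.
Qed.

Lemma kronE n (x : matalg R n) y i p j q :
  kron x y (kidx i p) (kidx j q) = x i j * y p q.
Proof. by rewrite castmxE !esymK !cast_ordKV mxtens.tensmxE. Qed.

Lemma kron_mul n (x x' : matalg R n) y y' :
  kron x y *m kron x' y' = kron (x *m x') (y *m y').
Proof.
apply: kidx_matrixP => i p j q; rewrite kronE !mxE sum_kidx mulr_suml.
apply: eq_bigr => k _; rewrite mulr_sumr; apply: eq_bigr => s _.
by rewrite !kronE mulrACA.
Qed.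

Lemma kron_tr n (x : matalg R n) y : \tr (kron x y) = \tr x * \tr y.
Proof.
rewrite /mxtrace sum_kidx mulr_suml; apply: eq_bigr => i _.
by rewrite mulr_sumr; apply: eq_bigr => p _; rewrite kronE.
Qed.

Lemma kron_adj n (x : matalg R n) y : madj (kron x y) = kron (madj x) (madj y).
Proof. by apply: kidx_matrixP => i p j q; rewrite !(madjE, kronE) rmorphM. Qed.

Lemma kronZl n c (x : matalg R n) y : kron (c *: x) y = c *: kron x y.
Proof. by apply: kidx_matrixP => i p j q; rewrite !(kronE, mxE) mulrA. Qed.

Lemma kron_suml n (I : Type) (r : seq I) (F : I -> matalg R n) y :
  kron (\sum_(k <- r) F k) y = \sum_(k <- r) kron (F k) y.
Proof.
apply: kidx_matrixP => i p j q; rewrite kronE !summxE mulr_suml.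
by apply: eq_bigr => k _; rewrite kronE.
Qed.

Definition haar_block n q : nat -> matalg R n :=
  if q == 0%N then haar (@rhat R) n else @mxunit R n.

Lemma haar_kron n q k : (k < 4 ^ n.+1)%N ->
  haar (@rhat R) n.+1 (4 ^ n.+1 * q + k) = kron (haar_block n q k) (rhat R q).
Proof.
move=> kn; rewrite /haar_block [LHS]/= mulnC divnMDl ?expn_gt0// divn_small// addn0.
rewrite modnMDl modn_small//.
by case: eqP => _; rewrite /amplify kron_mul mulmx1 mul1mx.
Qed.

Lemma sum2 (V : nmodType) (F : 'I_2 -> V) : \sum_p F p = F 0 + F 1.
Proof. by rewrite big_ord_recl big_ord1; congr (_ + F _); apply: val_inj. Qed.

Lemma rhat_ortho p q : (p < 4)%N -> (q < 4)%N ->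
  \tr (madj (rhat R p) *m rhat R q) = 2 * (p == q)%:R.
Proof.
rewrite tr_mulE !sum2 !madjE.
case: p => [|[|[|[|p]]]] //; case: q => [|[|[|[|q]]]] //; move=> _ _;
  rewrite /rhat /= !mxE /= ?rmorphN ?rmorph1 ?rmorph0 ?mulr1n ?mulr0n; ring.
Qed.

Lemma rhat_complete (p' p s' s : 'I_2) :
  \sum_(q < 4) rhat R q s' s * (rhat R q p' p)^* = 2 * (s' == p')%:R * (s == p)%:R.
Proof.
rewrite !big_ord_recl big_ord0 /rhat /= /bump /=.
case: p' => [[|[|//]] ?]; case: p => [[|[|//]] ?];
case: s' => [[|[|//]] ?]; case: s => [[|[|//]] ?];
  rewrite !mxE /= ?rmorphN ?rmorph1 ?rmorph0 ?mulr1n ?mulr0n; ring.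
Qed.

(** The component along [y |-> kron y (madj (rhat q))]: a partial trace. *)
Definition slice n q (b : matalg R n.+1) : matalg R n :=
  \matrix_(i, j) (2^-1 * \sum_p \sum_s b (kidx i p) (kidx j s) * rhat R q s p).

Lemma tr_slice n q (b : matalg R n.+1) (x : matalg R n) :
  \tr (b *m kron x (rhat R q)) = 2 * \tr (slice q b *m x).
Proof.
rewrite !tr_mulE sum_kidx mulr_sumr; apply: eq_bigr => i _.
under eq_bigr do rewrite sum_kidx.
rewrite exchange_big /= mulr_sumr; apply: eq_bigr => j _.
rewrite mxE !mulrA divff ?mul1r ?pnatr_eq0// mulr_suml; apply: eq_bigr => p _.
rewrite mulr_suml; apply: eq_bigr => s _.
by rewrite kronE mulrA mulrAC.
Qed.

(** The [rhat q] are an orthogonal basis of the two by two matrices. *)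
Lemma slice_complete n (b : matalg R n.+1) :
  \sum_(q < 4) kron (slice q b) (madj (rhat R q)) = b.
Proof.
apply: kidx_matrixP => i p j q; rewrite summxE.
under eq_bigr do rewrite kronE mxE madjE -mulrA mulr_suml.
rewrite -mulr_sumr exchange_big /=.
under eq_bigr => t _.
  under eq_bigr do rewrite mulr_suml.
  rewrite exchange_big /=.
  under eq_bigr => s _.
    under eq_bigr do rewrite -mulrA.
    rewrite -mulr_sumr rhat_complete.
    over.
  over.
rewrite (bigD1 p)//= (bigD1 q)//= !eqxx big1 => [|s /negPf ->]; last first.
    by rewrite !(mulr0, mul0r).
rewrite big1 => [|t /negPf tp]; last by rewrite big1// => s _; rewrite tp !mulr0.
by rewrite !addr0 !mulr1 mulrCA mulVf ?mulr1// pnatr_eq0.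
Qed.

End HaarMatrices.

(** * Orthogonal expansions of matrices *)

Section HaarExpansion.
Variable R : realType.
Local Notation C := R[i].

(** The term of [u] in the expansion of [b] along the orthogonal family of
    the [madj u] for the form [\tr (x *m madj y)]. *)
Definition coef_term m (u b : 'M[C]_m) : 'M[C]_m :=
  (\tr (b *m u) / \tr (madj u *m u)) *: madj u.

Lemma sum_ord_blocks (V : nmodType) (F : nat -> V) N q k :
  \sum_(j < N * q + k) F j =
  \sum_(p < q) \sum_(l < N) F (N * p + l)%N + \sum_(l < k) F (N * q + l)%N.
Proof.
rewrite big_split_ord /=; congr (_ + _).
elim: q => [|q IH]; first by rewrite muln0 !big_ord0.
rewrite mulnSr big_split_ord /= IH big_ord_recr /=; congr (_ + _).
Qed.

(** The inner product of [b] with a tensor [x] by [r_q] sees only the slice [q]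
    of [b], so expansions along tensors are computed slice by slice. *)
Lemma coef_term_kron n q (x : matalg R n) (b : matalg R n.+1) : (q < 4)%N ->
  coef_term (kron x (rhat R q)) b = kron (coef_term x (slice q b)) (madj (rhat R q)).
Proof.
move=> q4; rewrite /coef_term kron_adj kronZl; congr (_ *: _).
rewrite tr_slice kron_mul kron_tr rhat_ortho// eqxx mulr1.
by rewrite [2 * \tr _]mulrC -mulf_div divff ?mulr1// pnatr_eq0.
Qed.

(** As [N * N = 4 ^ n.+1] for matrices of size [N = 2 ^ n.+1], the enumeration
    exhausts the matrix units, and no [mxunit] of index in range vanishes. *)
Lemma mxunitP n m : (m < 4 ^ n.+1)%N ->
  exists i j : 'I_(2 ^ n.+1), shell i.+1 j.+1 = m.+1 /\ @mxunit R n m = delta_mx i j.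
Proof.
rewrite (expnMn 2 2) => /shell_surj[a [b [ha hb e]]].
exists (Ordinal ha), (Ordinal hb); split=> //; apply/matrixP => i j.
rewrite !mxE -e -!val_eqE /=; congr (nat_of_bool _)%:R.
by apply/eqP/andP => [/shell_inj[-> ->]//|[/eqP -> /eqP ->]].
Qed.

Lemma madj_delta m (i j : 'I_m) : madj (delta_mx i j : 'M[C]_m) = delta_mx j i.
Proof. by apply/matrixP => k l; rewrite madjE !mxE rmorph_nat andbC. Qed.

Lemma tr_mul_delta m (x : 'M[C]_m) i j : \tr (x *m delta_mx i j) = x j i.
Proof.
rewrite tr_mulE (bigD1 j)//= (bigD1 i)//= big1 => [|k ki]; last first.
  by rewrite mxE (negPf ki)/= mulr0.
rewrite big1 => [|k kj]; first by rewrite mxE !eqxx mulr1 !addr0.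
by rewrite big1// => l _; rewrite mxE (negPf kj) andbF mulr0.
Qed.

Lemma coef_term_mxunit n m (x : matalg R n) : (m < 4 ^ n.+1)%N ->
  coef_term (mxunit R n m) x =
  \matrix_(i, j) (x i j * (shell j.+1 i.+1 == m.+1)%:R).
Proof.
move=> /mxunitP[a [b [e ->]]]; rewrite /coef_term tr_mul_delta madj_delta.
rewrite tr_mul_delta !mxE !eqxx divr1; apply/matrixP => i j; rewrite !mxE -e.
have -> : (shell j.+1 i.+1 == shell a.+1 b.+1) = ((i == b) && (j == a)).
  rewrite -!val_eqE /=; apply/eqP/andP => [/shell_inj[-> ->]//|].
  by move=> [/eqP -> /eqP ->].
by case: eqP => [->|_]; case: eqP => [->|_] //=; rewrite ?mulr0.
Qed.

Lemma sum_coef_term_mxunit n k (x : matalg R n) : (k <= 4 ^ n.+1)%N ->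
  \sum_(m < k) coef_term (mxunit R n m) x =
  \matrix_(i, j) (x i j * (shell j.+1 i.+1 <= k)%:R).
Proof.
move=> kn; apply/matrixP => i j; rewrite summxE mxE.
under eq_bigr => m _ do rewrite coef_term_mxunit ?(leq_trans (ltn_ord m))// mxE.
rewrite -mulr_sumr; congr (_ * _); move: (shell_gt0 j i).
case: (shell _ _) => // s _ {kn}; rewrite -natr_sum; congr _%:R.
under eq_bigr do rewrite eqSS.
have [sk|ks] := ltnP s k.
  rewrite (bigD1 (Ordinal sk))//= eqxx big1// => m.
  by rewrite -val_eqE /= eq_sym => /negPf ->.
rewrite big1// => m _; case: eqP => // e; move: (ltn_ord m); rewrite -e; lia.
Qed.

Lemma shell_le_all n (i j : 'I_(2 ^ n.+1)) : (shell i.+1 j.+1 <= 4 ^ n.+1)%N.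
Proof. by rewrite (expnMn 2 2); exact: shell_le. Qed.

Lemma mxunit_complete n (x : matalg R n) :
  \sum_(m < 4 ^ n.+1) coef_term (mxunit R n m) x = x.
Proof.
rewrite sum_coef_term_mxunit//; apply/matrixP => i j.
by rewrite mxE shell_le_all mulr1.
Qed.

Lemma sum_block_haar n q k (b : matalg R n.+1) : (q < 4)%N -> (k <= 4 ^ n.+1)%N ->
  \sum_(l < k) coef_term (haar (@rhat R) n.+1 (4 ^ n.+1 * q + l)) b =
  kron (\sum_(l < k) coef_term (haar_block R n q l) (slice q b)) (madj (rhat R q)).
Proof.
move=> q4 kn; rewrite kron_suml; apply: eq_bigr => l _.
by rewrite haar_kron ?(leq_trans (ltn_ord l))// coef_term_kron.
Qed.

Lemma rhat_coef q (b : 'M[C]_2) : (q < 4)%N ->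
  coef_term (rhat R q) b = (2^-1 * \tr (b *m rhat R q)) *: madj (rhat R q).
Proof. by move=> q4; rewrite /coef_term rhat_ortho// eqxx mulr1 [_ / 2]mulrC. Qed.

(** At each level, the block [q = 0] expands the slice by the induction
    hypothesis and the others expand theirs along the matrix units. *)
Lemma haar_complete n (b : matalg R n) :
  \sum_(j < 4 ^ n.+1) coef_term (haar (@rhat R) n j) b = b.
Proof.
elim: n b => [|n IH] b.
  apply/matrixP => i j; rewrite summxE.
  under eq_bigr => q _.
    rewrite /= rhat_coef// mxE madjE tr_mulE -mulrA mulr_suml.
    under eq_bigr do rewrite mulr_suml.
    over.
  rewrite /= -mulr_sumr exchange_big /=.
  under eq_bigr => t _.
    rewrite exchange_big /=.
    under eq_bigr => s _.
      under eq_bigr do rewrite -mulrA.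
      rewrite -mulr_sumr rhat_complete.
      over.
    over.
  rewrite (bigD1 i)//= (bigD1 j)//= !eqxx big1 => [|s /negPf ->]; last first.
    by rewrite !(mulr0, mul0r).
  rewrite big1 => [|t /negPf tp]; last by rewrite big1// => s _; rewrite tp !mulr0.
  by rewrite !addr0 !mulr1 mulrCA mulVf ?mulr1// pnatr_eq0.
have -> : (4 ^ n.+2 = 4 ^ n.+1 * 4 + 0)%N by rewrite addn0 -expnSr.
rewrite (sum_ord_blocks (fun j => coef_term (haar (@rhat R) n.+1 j) b)) big_ord0 addr0.
rewrite -[RHS]slice_complete; apply: eq_bigr => q _; rewrite sum_block_haar//.
by congr (kron _ _); rewrite /haar_block; case: eqP => _; [exact: IH|exact: mxunit_complete].
Qed.

Lemma haar_block_ortho n q k l : (k < 4 ^ n.+1)%N -> (l < 4 ^ n.+1)%N ->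
  (forall i j, (i < 4 ^ n.+1)%N -> (j < 4 ^ n.+1)%N ->
    (\tr (madj (haar (@rhat R) n i) *m haar (@rhat R) n j) == 0) = (i != j)) ->
  (\tr (madj (haar_block R n q k) *m haar_block R n q l) == 0) = (k != l).
Proof.
move=> kn ln IH; rewrite /haar_block; case: (q =P 0%N) => _; first exact: IH.
have [a [b [ek ->]]] := mxunitP kn; have [c [d [el ->]]] := mxunitP ln.
rewrite madj_delta tr_mul_delta mxE -eqSS -ek -el [in LHS]andbC.
have -> : (shell a.+1 b.+1 == shell c.+1 d.+1) = ((c == a) && (d == b)).
  rewrite -!val_eqE /=; apply/eqP/andP => [/shell_inj[-> ->]//|].
  by move=> [/eqP -> /eqP ->].
by rewrite pnatr_eq0 eqb0 andbC.
Qed.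

Lemma haar_ortho n i j : (i < 4 ^ n.+1)%N -> (j < 4 ^ n.+1)%N ->
  (\tr (madj (haar (@rhat R) n i) *m haar (@rhat R) n j) == 0) = (i != j).
Proof.
elim: n i j => [|n IH] i j.
  move=> i4 j4; rewrite /= rhat_ortho// mulf_eq0 !pnatr_eq0 /=.
  by case: (i == j).
have N0 : (0 < 4 ^ n.+1)%N by rewrite expn_gt0.
have split4 m : (m < 4 ^ n.+2)%N -> exists q k,
    [/\ (q < 4)%N, (k < 4 ^ n.+1)%N & m = (4 ^ n.+1 * q + k)%N].
  move=> mn; exists (m %/ 4 ^ n.+1)%N, (m %% 4 ^ n.+1)%N.
  by rewrite ltn_divLR// -expnS mn ltn_pmod// mulnC -divn_eq.
move=> /split4[q [k [q4 kn ->]]] /split4[p [l [p4 ln ->]]].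
rewrite !haar_kron// kron_adj kron_mul kron_tr rhat_ortho// !mulf_eq0 !pnatr_eq0 eqb0 /=.
have [<-|qp] := eqVneq q p; last first.
  rewrite orbT; apply/esym/eqP => /(congr1 (divn ^~ (4 ^ n.+1)%N)).
  by rewrite ![(4 ^ n.+1 * _)%N]mulnC !divnMDl// !divn_small// !addn0; apply/eqP.
by rewrite orbF eqn_add2l haar_block_ortho.
Qed.

End HaarExpansion.

(** * Norm bounds for partial sums of matrices *)

Section FormBounds.
Variable R : realType.
Local Notation C := R[i].
Implicit Types K : C.

Definition sqnorm D (x : 'I_D -> C) : C := \sum_i `|x i| ^+ 2.

(** Boundedness of the sesquilinear form of [b] on column vectors; the
    least such [K] is half the operator norm of [b].  Unlike operator norms, these
    bounds are added up and restricted to blocks without Cauchy-Schwarz. *)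
Definition form_bounded D (b : 'M[C]_D) (K : C) := forall x z : 'I_D -> C,
  `|\sum_i \sum_j (z i)^* * b i j * x j| <= K * (sqnorm x + sqnorm z).

Lemma sqnorm_ge0 D (x : 'I_D -> C) : 0 <= sqnorm x.
Proof. by apply: sumr_ge0 => i _; rewrite exprn_ge0. Qed.

Lemma form_bounded_le D (b : 'M[C]_D) K K' : K <= K' ->
  form_bounded b K -> form_bounded b K'.
Proof.
move=> KK hb x z; rewrite (le_trans (hb x z))// ler_wpM2r//.
by rewrite addr_ge0// sqnorm_ge0.
Qed.

Lemma form_bounded0 D : form_bounded (0 : 'M[C]_D) 0.
Proof.
move=> x z; rewrite mul0r big1 ?normr0// => i _.
by rewrite big1// => j _; rewrite mxE mulr0 mul0r.
Qed.

Lemma form_boundedD D (b c : 'M[C]_D) K K' :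
  form_bounded b K -> form_bounded c K' -> form_bounded (b + c) (K + K').
Proof.
move=> hb hc x z; rewrite mulrDl (le_trans _ (lerD (hb x z) (hc x z)))//.
rewrite [X in `|X| <= _](_ : _ = \sum_i \sum_j (z i)^* * b i j * x j +
  \sum_i \sum_j (z i)^* * c i j * x j); first exact: ler_normD.
rewrite -big_split; apply: eq_bigr => i _; rewrite -big_split; apply: eq_bigr => j _.
by rewrite mxE mulrDr mulrDl.
Qed.

Lemma form_bounded_sum D q (F : nat -> 'M[C]_D) K :
  (forall p, (p < q)%N -> form_bounded (F p) K) ->
  form_bounded (\sum_(p < q) F p) (q%:R * K).
Proof.
elim: q => [|q IH] hF; first by rewrite big_ord0 mul0r; exact: form_bounded0.
rewrite big_ord_recr -natr1 mulrDl mul1r; apply: form_boundedD; last exact: hF.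
by apply: IH => p pq; apply: hF; exact: ltnW.
Qed.

Lemma form_boundedZ D (b : 'M[C]_D) c K :
  form_bounded b K -> form_bounded (c *: b) (`|c| * K).
Proof.
move=> hb x z; rewrite -mulrA.
rewrite [X in `|X| <= _](_ : _ = c * \sum_i \sum_j (z i)^* * b i j * x j).
  by rewrite normrM ler_wpM2l.
rewrite mulr_sumr; apply: eq_bigr => i _; rewrite mulr_sumr; apply: eq_bigr => j _.
by rewrite mxE; ring.
Qed.

Lemma form_bounded_rectangle D (b : 'M[C]_D) K (P Q : pred 'I_D) : 0 <= K ->
  form_bounded b K -> form_bounded (\matrix_(i, j) (b i j * (P i && Q j)%:R)) K.
Proof.
move=> K0 hb x z.
have := hb (fun j => (Q j)%:R * x j) (fun i => (P i)%:R * z i).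
rewrite (eq_bigr (fun i => \sum_j (z i)^* *
    (\matrix_(i, j) (b i j * (P i && Q j)%:R)) i j * x j)); last first.
  move=> i _; apply: eq_bigr => j _; rewrite mxE rmorphM rmorph_nat -mulnb natrM; ring.
move/le_trans; apply; rewrite ler_wpM2l// lerD//; apply: ler_sum => i _.
  by case: (Q i); rewrite ?mul1r// mul0r normr0 expr0n exprn_ge0.
by case: (P i); rewrite ?mul1r// mul0r normr0 expr0n exprn_ge0.
Qed.

Lemma sum_pick (V : nmodType) (p : 'I_2) (F : V) :
  \sum_(s : 'I_2) (if s == p then F else 0) = F.
Proof. by rewrite -big_mkcond big_pred1_eq. Qed.

Lemma sqnorm_kidx n (x : 'I_(2 ^ n.+2) -> C) :
  sqnorm x = \sum_p sqnorm (fun i => x (kidx i p)).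
Proof. by rewrite /sqnorm sum_kidx exchange_big. Qed.

Lemma sqnorm_slice_le n (x : 'I_(2 ^ n.+2) -> C) p :
  sqnorm (fun i => x (kidx i p)) <= sqnorm x.
Proof.
rewrite sqnorm_kidx (bigD1 p)//= lerDl; apply: sumr_ge0 => *; exact: sqnorm_ge0.
Qed.

(** The form of a block is the form of [b] on vectors supported in that block. *)
Lemma form_bounded_block n (b : matalg R n.+1) K p s :
  form_bounded b K -> form_bounded (\matrix_(i, j) b (kidx i p) (kidx j s)) K.
Proof.
move=> hb x z.
pose lift r (y : 'I_(2 ^ n.+1) -> C) (k : 'I_(2 ^ n.+2)) :=
  if (kidx_inv k).2 == r then y (kidx_inv k).1 else 0.
have lift_sq r y : sqnorm (lift r y) = sqnorm y.
  rewrite /sqnorm sum_kidx; apply: eq_bigr => i _.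
  rewrite -[RHS](sum_pick r); apply: eq_bigr => t _.
  by rewrite /lift kidxK /=; case: ifP => _ //; rewrite normr0 expr0n.
have := hb (lift s x) (lift p z); rewrite !lift_sq.
congr (`|_| <= _); rewrite sum_kidx; apply: eq_bigr => i _.
rewrite (eq_bigr (fun t => if t == p then \sum_j (z i)^* *
    (\matrix_(i, j) b (kidx i p) (kidx j s)) i j * x j else 0)) ?sum_pick// => t _.
case: ifP => [/eqP ->|tp]; last first.
  by rewrite big1// => k _; rewrite /lift kidxK /= tp rmorph0 !mul0r.
rewrite sum_kidx; apply: eq_bigr => j _.
rewrite -[RHS](sum_pick s); apply: eq_bigr => r _.
rewrite /lift !kidxK /= eqxx mxE; case: ifP => [/eqP ->//|_]; exact: mulr0.
Qed.

Lemma rhat_le1 q (p s : 'I_2) : (q < 4)%N -> `|rhat R q s p| <= 1.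
Proof.
case: q => [|[|[|[|q]]]] // _; case: p => [[|[|//]] ?]; case: s => [[|[|//]] ?];
  by rewrite /rhat /= !mxE /= ?normrN ?normr1 ?normr0 ?mulr1n ?mulr0n ?normr1 ?normr0.
Qed.

Lemma form_bounded_slice n q (b : matalg R n.+1) K : (q < 4)%N -> 0 <= K ->
  form_bounded b K -> form_bounded (slice q b) (2 * K).
Proof.
move=> q4 K0 hb.
have -> : slice q b = \sum_p \sum_s (2^-1 * rhat R q s p) *:
    \matrix_(i, j) b (kidx i p) (kidx j s).
  apply/matrixP => i j; rewrite mxE summxE mulr_sumr; apply: eq_bigr => p _.
  rewrite summxE mulr_sumr; apply: eq_bigr => s _; rewrite !mxE; ring.
have h p s : form_bounded ((2^-1 * rhat R q s p) *:
    \matrix_(i, j) b (kidx i p) (kidx j s)) (2^-1 * K).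
  apply: (form_bounded_le _ (form_boundedZ _ (form_bounded_block p s hb))).
  rewrite ler_wpM2r// normrM ger0_norm ?invr_ge0// ler_piMr ?invr_ge0//.
  exact: rhat_le1.
rewrite !sum2; have -> : 2 * K = 2^-1 * K + 2^-1 * K + (2^-1 * K + 2^-1 * K) by field.
by do 2 (apply: form_boundedD).
Qed.

Lemma form_bounded_kron_delta n (b : matalg R n) K p s : 0 <= K ->
  form_bounded b K -> form_bounded (kron b (delta_mx p s)) K.
Proof.
move=> K0 hb x z.
have := hb (fun j => x (kidx j s)) (fun i => z (kidx i p)).
set L := (L in `|L|); set L' := (L' in _ -> `|L'| <= _).
have -> : L = L'.
  rewrite /L' sum_kidx; apply: eq_bigr => i _.
  rewrite (bigD1 p)//= [X in _ + X]big1 => [|t /negPf tp]; last first.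
    rewrite big1// => k _; rewrite -(kidx_invK k) kronE mxE tp/=.
    by rewrite !(mulr0, mul0r).
  rewrite addr0 sum_kidx; apply: eq_bigr => j _.
  rewrite (bigD1 s)//= big1 => [|t /negPf ts]; last first.
    by rewrite kronE mxE ts andbF !(mulr0, mul0r).
  by rewrite addr0 kronE mxE !eqxx mulr1.
by move/le_trans; apply; rewrite ler_wpM2l// lerD// sqnorm_slice_le.
Qed.

Lemma form_bounded_kron n (b : matalg R n) K (y : 'M[C]_2) : 0 <= K ->
  (forall p s, `|y p s| <= 1) ->
  form_bounded b K -> form_bounded (kron b y) (4 * K).
Proof.
move=> K0 hy hb.
have -> : kron b y = \sum_p \sum_s y p s *: kron b (delta_mx p s).
  apply: kidx_matrixP => i p j s; rewrite kronE summxE.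
  rewrite (bigD1 p)//= summxE (bigD1 s)//= !mxE kronE mxE !eqxx mulr1.
  rewrite big1 => [|t /negPf ts]; last by rewrite mxE kronE mxE eq_sym ts andbF !mulr0.
  rewrite big1 => [|t /negPf tp]; first by rewrite !addr0 mulrC.
  rewrite summxE big1// => r _; by rewrite mxE kronE mxE eq_sym tp !mulr0.
have h p s : form_bounded (y p s *: kron b (delta_mx p s)) K.
  apply: (form_bounded_le _ (form_boundedZ _ (form_bounded_kron_delta p s K0 hb))).
  by rewrite ler_piMl.
rewrite !sum2; have -> : 4 * K = K + K + (K + K) by ring.
by do 2 (apply: form_boundedD).
Qed.

(** The amplified form is a direct sum of two copies of the form of [b], so the
    constant does not grow with the level. *)
Lemma form_bounded_amplify n (b : matalg R n) K :
  form_bounded b K -> form_bounded (amplify b) K.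
Proof.
move=> hb x z; rewrite !sqnorm_kidx -big_split mulr_sumr.
rewrite sum_kidx exchange_big /=.
apply: le_trans (ler_norm_sum _ _ _) _; apply: ler_sum => p _.
apply: le_trans (hb _ _).
rewrite [X in `|X| <= _](eq_bigr (fun i => \sum_j (z (kidx i p))^* * b i j * x (kidx j p)))//.
move=> i _; rewrite sum_kidx; apply: eq_bigr => j _.
rewrite (bigD1 p)//= big1 => [|t /negPf tp]; last first.
  by rewrite kronE mxE eq_sym tp !(mulr0, mul0r).
by rewrite addr0 kronE mxE eqxx mulr1.
Qed.

(** Column by column, the trace is a sum of values of the form of [b]. *)
Lemma form_bounded_trace D (b c d : 'M[C]_D) K : form_bounded b K ->
  `|\tr (madj d *m (b *m c))| <= K * (\tr (madj c *m c) + \tr (madj d *m d)).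
Proof.
move=> hb.
have sq (y : 'M[C]_D) : \tr (madj y *m y) = \sum_l sqnorm (fun i => y i l).
  rewrite tr_mulE; apply: eq_bigr => l _; apply: eq_bigr => i _.
  by rewrite madjE normCK mulrC.
rewrite !sq -big_split mulr_sumr tr_mulE /=.
apply: le_trans (ler_norm_sum _ _ _) _; apply: ler_sum => l _.
apply: le_trans (hb _ _).
rewrite [X in `|X| <= _](eq_bigr (fun i => \sum_j (d i l)^* * b i j * c j l))//.
by move=> i _; rewrite madjE mxE mulr_sumr; apply: eq_bigr => j _; rewrite mulrA.
Qed.

(** The three parts of the truncation are compressions to rectangles. *)
Lemma form_bounded_shell D (b : 'M[C]_D) K k : 0 <= K -> form_bounded b K ->
  form_bounded (\matrix_(i, j) (b i j * (shell j.+1 i.+1 <= k)%:R)) (3 * K).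
Proof.
move=> K0 hb; have [M hM] := shell_corner k.
pose rect (P Q : pred nat) : 'M[C]_D := \matrix_(i, j) (b i j * (P i && Q j)%:R).
have -> : \matrix_(i, j) (b i j * (shell j.+1 i.+1 <= k)%:R) =
    rect (fun i => i < M)%N (fun j => j < M)%N +
    rect (fun i => i == M) (fun j => (M * M + j < k) && (j <= M))%N +
    rect (fun i => (i < M) && (M * M + 2 * M - i < k))%N (fun j => j == M).
  apply/matrixP => i j; rewrite !mxE -!mulrDr hM -!natrD; congr (_ * _%:R).
  move: (M * M + j < k)%N (M * M + 2 * M - i < k)%N => u v.
  by case: (ltngtP i M) => iM; case: (ltngtP j M) => jM; case: u; case: v.
have h P Q : form_bounded (rect P Q) K by exact: form_bounded_rectangle.
have -> : 3 * K = K + K + K by ring.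
by apply: form_boundedD => //; exact: form_boundedD.
Qed.

(** Past the first [4 ^ n.+1] terms, a partial sum of the expansion consists of
    complete slices and of one truncated slice, hence the uniform bound. *)
Lemma form_bounded_haar_sum n m (b : matalg R n.+1) K : 0 <= K ->
  (4 ^ n.+1 <= m < 4 ^ n.+2)%N -> form_bounded b K ->
  form_bounded (\sum_(j < m) coef_term (haar (@rhat R) n.+1 j) b) (48 * K).
Proof.
move=> K0 /andP[nm mn] hb.
have N0 : (0 < 4 ^ n.+1)%N by rewrite expn_gt0.
pose q := (m %/ 4 ^ n.+1)%N; pose k := (m %% 4 ^ n.+1)%N.
have q4 : (q < 4)%N by rewrite ltn_divLR// -expnS.
have q0 : (0 < q)%N by rewrite divn_gt0.
have kn : (k < 4 ^ n.+1)%N by rewrite ltn_pmod.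
have -> : m = (4 ^ n.+1 * q + k)%N by rewrite mulnC -divn_eq.
rewrite (sum_ord_blocks (fun j => coef_term (haar (@rhat R) n.+1 j) b)).
have K2 : 0 <= 2 * K by rewrite mulr_ge0.
have le1 p : (p < 4)%N -> forall s t, `|madj (rhat R p) s t| <= 1.
  by move=> p4 s t; rewrite madjE norm_conjC rhat_le1.
(* At most three complete slices, and one truncated slice; a slice costs a
   factor 2, a tensor product with [madj (rhat q)] a factor 4, the truncation a factor 3. *)
have -> : 48 * K = 3 * (4 * (2 * K)) + 4 * (3 * (2 * K)) by ring.
apply: form_boundedD; last first.
  rewrite sum_block_haar ?(ltnW kn)// /haar_block gtn_eqF//.
  apply: form_bounded_kron; [by rewrite !mulr_ge0|exact: le1|].
  rewrite sum_coef_term_mxunit ?(ltnW kn)//.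
  by apply: form_bounded_shell => //; exact: form_bounded_slice.
apply: (@form_bounded_le _ _ (q%:R * (4 * (2 * K)))).
  by rewrite ler_wpM2r ?mulr_ge0// ler_nat -ltnS.
apply: (@form_bounded_sum _ _ (fun p => \sum_(l < 4 ^ n.+1)
  coef_term (haar (@rhat R) n.+1 (4 ^ n.+1 * p + l)) b)) => p pq.
have p4 : (p < 4)%N by exact: ltn_trans pq q4.
rewrite sum_block_haar//.
apply: form_bounded_kron => //; first exact: le1.
rewrite [X in form_bounded X _](_ : _ = slice p b); first exact: form_bounded_slice.
rewrite /haar_block; case: (p =P 0%N) => [->|_]; first exact: haar_complete.
exact: mxunit_complete.
Qed.

End FormBounds.

(** * Partial sums of operators of the factor *)

Section HyperfiniteFactor.
Variables (R : realType) (A : completeNormedModType R[i]) (cs : cstar A).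
Variables (iota : forall n : nat, matalg R n -> A) (rho : A -> R[i]).
Variables (H : completeNormedModType R[i]) (ip : {dot H for @Num.conj R[i]}).
Variables (pi : A -> H -> H) (Omega : H).
Hypothesis hA : cstar_inductive_limit cs iota.
Hypothesis hrho : induced_trace_state cs iota rho.
Hypothesis hpi : is_gns cs rho ip pi Omega.
Local Notation C := R[i].

Let hilb : hilbert_norm ip := gns_hilbert hpi.
Let bpi a : bounded_operator (pi a) := gns_bounded hpi a.
Let state : is_state cs rho := hrho.1.
Local Notation "a ** b" := (cmul cs a b) (at level 40, left associativity).
Local Notation "a ^#" := (cadj cs a) (at level 2, format "a ^#").
Local Notation vec a := (pi a Omega).
Local Notation N := (commutant (commutant (range pi))).
Local Notation h n j := (haar (@rhat R) n j).

Lemma functional_sum (V : lmodType C) (L : V -> C) (I : Type) (r : seq I)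
    (k : I -> C) (v : I -> V) :
  (forall c u w, L (c *: u + w) = c * L u + L w) ->
  L (\sum_(i <- r) k i *: v i) = \sum_(i <- r) k i * L (v i).
Proof.
move=> hL; have L0 : L 0 = 0.
  by have := hL (-1) 0 0; rewrite scaler0 addr0 mulN1r addNr.
elim: r => [|i r IH]; first by rewrite !big_nil.
by rewrite !big_cons hL IH.
Qed.

Lemma rho_iota n (x : matalg R n) : rho (iota x) = (2 ^+ n.+1)^-1 * \tr x.
Proof. exact: hrho.2. Qed.

Lemma iota_madj n (x : matalg R n) : iota (madj x) = (iota x)^#.
Proof. exact: (iota_adj hA). Qed.

(** Finitely many elements of the matrix algebras can be brought to a common
    level; [P] carries along what amplification preserves. *)
Lemma iota_raise n m (x : matalg R n) (P : forall k, matalg R k -> Prop) :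
  (n <= m)%N -> P n x -> (forall k y, P k y -> P k.+1 (amplify y)) ->
  exists2 y : matalg R m, P m y & iota y = iota x.
Proof.
move=> nm Px Pamp; rewrite -(subnK nm); elim: (m - n)%N => [|k [y Py e]].
  by exists x.
by exists (amplify y); [exact: Pamp|rewrite (iota_compat hA)].
Qed.

Lemma iota_approx a (e : C) : 0 < e -> exists n (x : matalg R n), `|a - iota x| <= e.
Proof.
move=> /(closure_approx (iota_dense hA) a)[_ [n _ [x _ <-]] hx].
by exists n, x.
Qed.

Lemma rho_lin c a b : rho (c *: a + b) = c * rho a + rho b.
Proof. exact: (state_linear state). Qed.

Lemma rhoB a b : rho (a - b) = rho a - rho b.
Proof. by rewrite addrC -scaleN1r rho_lin mulN1r addrC. Qed.

(** The identity holds for the matrix traces and extends by density, in one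
    variable at a time. *)
Lemma rho_tracial a b : rho (a ** b) = rho (b ** a).
Proof.
have dense (b' : A) :
    (forall n (x : matalg R n), rho (iota x ** b') = rho (b' ** iota x)) ->
    forall a', rho (a' ** b') = rho (b' ** a').
  move=> hb a'; apply/eqP; rewrite -subr_eq0; apply/eqP.
  apply: (@eq0_small _ _ _ (`|b'| * 2)) => [|e e0]; first by rewrite mulr_ge0.
  have [n [x hx]] := iota_approx a' e0.
  have -> : rho (a' ** b') - rho (b' ** a') =
      rho ((a' - iota x) ** b') - rho (b' ** (a' - iota x)).
    have cmulBr u v w : w ** (u - v) = w ** u - w ** v.
      by rewrite addrC -scaleN1r cmul_linearr scaleN1r addrC.
    by rewrite cmulBl cmulBr !rhoB hb opprB addrA subrK.
  rewrite (le_trans (ler_normB _ _))// -mulrA mulr_natl mulr2n mulrDr lerD//.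
    rewrite (le_trans (state_bounded state _))// (le_trans (cnormM _ _ _))//.
    by rewrite mulrC ler_wpM2l.
  rewrite (le_trans (state_bounded state _))// (le_trans (cnormM _ _ _))//.
  by rewrite ler_wpM2l.
apply: (dense b) => n x; apply/esym/(dense (iota x)) => m y.
have [x' _ <-] := iota_raise (m := (n + m)%N) (P := fun _ _ => True) (x := x)
  (leq_addr _ _) I ltac:(by []).
have [y' _ <-] := iota_raise (m := (n + m)%N) (P := fun _ _ => True) (x := y)
  (leq_addl _ _) I ltac:(by []).
by rewrite -!(iota_mul hA) !rho_iota mxtrace_mulC.
Qed.

Let pi_lin := gns_linear hpi.

Lemma piN a : N (pi a).
Proof.
by apply: sub_double_commutant => [_ [b _ <-]|]; [exact: bpi|exists a].
Qed.

Lemma gns_factorE : gns_factor ip pi = N.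
Proof.
apply: vn_generated_double_commutant => // [_ [a _ <-]|_ [a _ <-]]; first exact: bpi.
by exists (pi a^#); [exists a^#|exact: (gns_adj hpi)].
Qed.

Lemma ip_vec_trace X a b : N X -> ip (X (vec a)) (vec b) = ip (X (vec (a ** b^#))) Omega.
Proof.
move=> NX; rewrite (pi_adjr hpi).
have NXa : N (X \o pi a) by apply: commutant_comp => //; exact: piN.
rewrite (pi_comp hpi).
by have := double_commutant_tracial rho_tracial hpi (piN b^#) NXa.
Qed.

Lemma haar_iota n j : (j < 4 ^ n.+1)%N -> iota (h j j) = iota (h n j).
Proof.
have step m k : (j < 4 ^ k.+1)%N -> iota (h (m + k) j) = iota (h k j).
  move=> jk; elim: m => // m <-; rewrite addSn haar_rhat_amplify ?(iota_compat hA)//.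
  by rewrite (leq_trans jk)// leq_exp2l// ltnS leq_addl.
have jj : (j < 4 ^ j.+1)%N by rewrite (ltn_trans (ltnSn j))// ltn_expl.
move=> jn; have [nj|/ltnW nj] := leqP n j.
  by rewrite -(step (j - n)%N n)// subnK.
by rewrite -(step (n - j)%N j)// subnK.
Qed.

Let hA_ j : A := iota (h j j).

Lemma haar_rho_ortho i j : i != j -> rho ((hA_ i)^# ** hA_ j) = 0.
Proof.
move=> ij; pose n := (i + j)%N.
have ki k : (k <= n)%N -> (k < 4 ^ n.+1)%N.
  by move=> kn; rewrite (leq_ltn_trans kn)// (ltn_trans (ltnSn n))// ltn_expl.
rewrite /hA_ (@haar_iota n i) ?ki ?leq_addr// (@haar_iota n j) ?ki ?leq_addl//.
rewrite -iota_madj -(iota_mul hA) rho_iota.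
by apply/eqP; rewrite mulf_eq0 haar_ortho ?ki ?leq_addr ?leq_addl// ij orbT.
Qed.

Definition haar_weight j : C := rho ((hA_ j)^# ** hA_ j).

Lemma haar_weightE n j : (j < 4 ^ n.+1)%N ->
  haar_weight j = (2 ^+ n.+1)^-1 * \tr (madj (h n j) *m h n j).
Proof.
by move=> jn; rewrite /haar_weight /hA_ (haar_iota jn) -iota_madj -(iota_mul hA) rho_iota.
Qed.

Lemma haar_weight_neq0 j : haar_weight j != 0.
Proof.
have jj : (j < 4 ^ j.+1)%N by rewrite (ltn_trans (ltnSn j))// ltn_expl.
rewrite (haar_weightE jj); apply: mulf_neq0.
  by rewrite invr_eq0 expf_neq0// pnatr_eq0.
by rewrite haar_ortho// negbK.
Qed.

Lemma vec_sq_iota n (x : matalg R n) :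
  `|vec (iota x)| ^+ 2 = (2 ^+ n.+1)^-1 * \tr (madj x *m x).
Proof. by rewrite (norm_vec hpi) -iota_madj -(iota_mul hA) rho_iota. Qed.

(** The conditional expectation of [T] onto the [n]-th matrix algebra. *)
Definition cond_exp n (T : H -> H) : matalg R n :=
  \matrix_(i, j) (2 ^+ n.+1 * ip (T (vec (iota (delta_mx j i : matalg R n)))) Omega).

Lemma functional_lin T : bounded_operator T ->
  forall c a b, ip (T (vec (c *: a + b))) Omega =
    c * ip (T (vec a)) Omega + ip (T (vec b)) Omega.
Proof. by move=> bT c a b; rewrite pi_lin (bop_lin bT) ipDl ipZl. Qed.

Lemma tr_cond_exp n T (x : matalg R n) : bounded_operator T ->
  \tr (cond_exp n T *m x) = 2 ^+ n.+1 * ip (T (vec (iota x))) Omega.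
Proof.
move=> bT; pose L (y : matalg R n) := ip (T (vec (iota y))) Omega.
have Llin c u w : L (c *: u + w) = c * L u + L w.
  by rewrite /L (iota_linear hA) functional_lin.
have sum_lin (F : 'I_(2 ^ n.+1) -> matalg R n) : L (\sum_i F i) = \sum_i L (F i).
  have := functional_sum (index_enum 'I_(2 ^ n.+1)) (fun=> 1) F Llin.
  by under eq_bigr do rewrite scale1r; under [in RHS]eq_bigr do rewrite mul1r.
rewrite -[ip _ _]/(L x) {2}(matrix_sum_delta x) sum_lin tr_mulE exchange_big mulr_sumr.
apply: eq_bigr => i _; rewrite functional_sum// mulr_sumr; apply: eq_bigr => j _.
by rewrite mxE -mulrA; congr (_ * _); rewrite mulrC.
Qed.

(** The form at [x, z] is a multiple of [ip (T u) v], where [u] and [v] are the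
    vectors of the matrices with first column [x] and [z] and no other nonzero
    column. *)
Lemma cond_exp_bounded n T : N T -> (forall v, `|T v| <= `|v|) ->
  form_bounded (cond_exp n T) 1.
Proof.
move=> NT T1 x z; rewrite mul1r.
have D0 : (0 < 2 ^ n.+1)%N by rewrite expn_gt0.
pose first_col (y : 'I_(2 ^ n.+1) -> C) : matalg R n :=
  \matrix_(i, l) (y i * (l == Ordinal D0)%:R).
have colsq y : \tr (madj (first_col y) *m first_col y) = sqnorm y.
  rewrite tr_mulE (bigD1 (Ordinal D0))//= [X in _ + X]big1 => [|l /negPf l0]; last first.
    by rewrite big1// => i _; rewrite madjE !mxE l0 mulr0 rmorph0 mul0r.
  by rewrite addr0; apply: eq_bigr => i _; rewrite madjE !mxE eqxx !mulr1 normCK mulrC.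
have rank1 j i : (first_col x *m madj (first_col z)) j i = x j * (z i)^*.
  rewrite mxE (bigD1 (Ordinal D0))//=. rewrite big1 => [|l /negPf l0]; last first.
    by rewrite mxE l0 mulr0 mul0r.
  by rewrite addr0 madjE !mxE eqxx !mulr1.
have -> : \sum_i \sum_j (z i)^* * cond_exp n T i j * x j =
    \tr (cond_exp n T *m (first_col x *m madj (first_col z))).
  rewrite tr_mulE; apply: eq_bigr => i _; apply: eq_bigr => j _.
  by rewrite rank1 mulrA [RHS]mulrC mulrA.
rewrite (tr_cond_exp _ NT.1) (iota_mul hA) iota_madj.
have p0 : 0 < 2 ^+ n.+1 :> C by rewrite exprn_gt0.
rewrite -ip_vec_trace// normrM gtr0_norm// -ler_pdivlMl//.
rewrite -!colsq mulrDr -!vec_sq_iota.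
rewrite (le_trans (cauchy_schwarz hilb _ _))//.
rewrite (le_trans (ler_wpM2r _ (T1 _)))//.
exact: mulr_le_sumsq.
Qed.

Lemma iota0 n : iota (0 : matalg R n) = 0.
Proof.
have := iota_linear hA (-1) (0 : matalg R n) 0.
by rewrite scaler0 addr0 scaleN1r addNr.
Qed.

Lemma iotaZ n t (x : matalg R n) : iota (t *: x) = t *: iota x.
Proof. by have := iota_linear hA t x 0; rewrite iota0 !addr0. Qed.

Lemma vecZ t a : vec (t *: a) = t *: vec a.
Proof. by have := vec_lin hpi t a 0; rewrite (vec0 hpi) !addr0. Qed.

Lemma vec_iota_approx v (e : C) : 0 < e ->
  exists n (c : matalg R n), `|v - vec (iota c)| <= e.
Proof.
move=> e0; have e2 : 0 < e / 2 by rewrite divr_gt0.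
have [a ha] := vec_approx hpi v e2; have [n [c hc]] := iota_approx a e2.
exists n, c; rewrite (le_trans (ler_distD (vec a) _ _))// [leRHS]splitr lerD//.
by rewrite -(vecB hpi) (le_trans (norm_vec_le state hpi _)).
Qed.

(** On a vector [vec (iota c)], the form bound is applied with the second
    vector proportional to [b *m c], scaled so that both have the same norm. *)
Lemma pi_form_bound n (b : matalg R n) K : 0 <= K -> form_bounded b K ->
  forall v, `|pi (iota b) v| <= 2 * K * `|v|.
Proof.
move=> K0 hb; have K2 : 0 <= 2 * K by rewrite mulr_ge0.
have dense m (c : matalg R m) :
    `|pi (iota b) (vec (iota c))| <= 2 * K * `|vec (iota c)|.
  have [b' hb' <-] := iota_raise (m := (n + m)%N) (P := fun k y => form_bounded y K)
    (leq_addr _ _) hb ltac:(by move=> k y; exact: form_bounded_amplify).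
  have [c' _ <-] := iota_raise (m := (n + m)%N) (P := fun _ _ => True) (x := c)
    (leq_addl _ _) I ltac:(by []).
  rewrite -(pi_comp hpi) -(iota_mul hA).
  set p := `|vec (iota c')|; set q := `|vec (iota (b' *m c'))|.
  have [p0|p0] := eqVneq p 0.
    have c0 : vec (iota c') = 0 by apply/eqP; rewrite -normr_eq0 -/p p0.
    by rewrite /q (iota_mul hA) (pi_comp hpi) c0 (bop0 (bpi _)) normr0 p0 mulr0.
  have [q0|q0] := eqVneq q 0; first by rewrite q0 mulr_ge0 ?normr_ge0.
  have pp : 0 < p by rewrite lt_def p0 normr_ge0.
  have qp : 0 < q by rewrite lt_def q0 normr_ge0.
  (* The second vector is scaled to the norm [p] of the first one. *)
  have [t t0 tq] : exists2 t : C, 0 < t & t * q = p.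
    by exists (p / q); [rewrite divr_gt0|rewrite divfK].
  pose d := t *: (b' *m c').
  have := form_bounded_trace c' d hb'.
  have w0 : 0 < (2 ^+ (n + m).+1)^-1 :> C by rewrite invr_gt0 exprn_gt0.
  rewrite -(ler_pM2l w0) -{1}(gtr0_norm w0) -normrM -rho_iota.
  rewrite (iota_mul hA) iota_madj -(ip_vec hpi) mulrCA mulrDr -!vec_sq_iota.
  have -> : vec (iota d) = t *: vec (iota (b' *m c')).
    by rewrite /d iotaZ vecZ.
  rewrite ipZr hilb normrM norm_conjC normrZ (gtr0_norm t0) -/q -/p.
  rewrite ger0_norm ?exprn_ge0 ?normr_ge0// [q ^+ 2]expr2 mulrA tq.
  have -> : K * (p ^+ 2 + p ^+ 2) = p * (2 * K * p) by ring.
  by rewrite ler_pM2l.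
move=> v; have [K' K'0 hK'] := bounded_operator_bound (bpi (iota b)).
apply/ler_addgt0Pr => e e0.
have M0 : 0 < 2 * K + K' by rewrite ltr_wpDl.
pose d := e / (2 * K + K').
have d0 : 0 < d by rewrite divr_gt0.
have [m [c hv]] := vec_iota_approx v d0.
have hv' : `|vec (iota c)| <= `|v| + d.
  rewrite -{1}(subKr v (vec (iota c))) (le_trans (ler_normB _ _))// lerD2l.
  exact: hv.
rewrite -{1}(subrK (vec (iota c)) v) (bopD (bpi _)) (le_trans (ler_normD _ _))//.
apply: (@le_trans _ _ (K' * d + 2 * K * (`|v| + d))).
  rewrite lerD//; first by rewrite (le_trans (hK' _))// ler_pM2l.
  by rewrite (le_trans (dense _ _))// ler_wpM2l.
rewrite mulrDr addrCA lerD2l -mulrDl addrC mulrC /d divfK ?gt_eqF//.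
Qed.

(** An element of [A] rather than an operator, so that a functional linear in [a]
    through [pi a] can be evaluated on it term by term. *)
Definition partial_sum m (T : H -> H) : A :=
  \sum_(j < m) (ip (T (vec (hA_ j))) Omega / haar_weight j) *: (hA_ j)^#.

Lemma iota_sum n (I : Type) (r : seq I) (k : I -> C) (F : I -> matalg R n) :
  iota (\sum_(i <- r) k i *: F i) = \sum_(i <- r) k i *: iota (F i).
Proof.
elim: r => [|i r IH]; first by rewrite !big_nil iota0.
by rewrite !big_cons (iota_linear hA) IH.
Qed.

(** Up to level [n], the partial sums see only the conditional expectation. *)
Lemma partial_sumE n m T : bounded_operator T -> (m <= 4 ^ n.+1)%N ->
  partial_sum m T = iota (\sum_(j < m) coef_term (h n j) (cond_exp n T)).
Proof.
move=> bT mn; rewrite iota_sum; apply: eq_bigr => j _.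
have jn : (j < 4 ^ n.+1)%N by exact: leq_trans (ltn_ord j) mn.
rewrite iota_madj /hA_ (haar_iota jn) tr_cond_exp// (haar_weightE jn).
congr (_ *: _); rewrite invfM invrK mulrA [_ * 2 ^+ _]mulrC.
by [].
Qed.

Lemma partial_sum_bound m T : N T -> (forall v, `|T v| <= `|v|) -> (4 <= m)%N ->
  forall v, `|pi (partial_sum m T) v| <= 96 * `|v|.
Proof.
move=> NT T1 m4.
have [n /andP[n1 n2]] : exists n, (4 ^ n.+1 <= m < 4 ^ n.+2)%N.
  have m0 : (0 < m)%N by exact: leq_trans m4.
  have := trunc_log_bounds (p := 4) isT m0.
  case: (trunc_log 4 m) => [|n] hn; last by exists n.
  by case/andP: hn => _ /leq_trans/(_ m4); rewrite ltnn.
rewrite (@partial_sumE n.+1)//; [|exact: NT.1|exact: ltnW].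
have -> : 96 = 2 * (48 * 1) :> C by rewrite mulr1 -natrM.
apply: pi_form_bound; first by rewrite mulr1.
by apply: form_bounded_haar_sum; [exact: ler01|rewrite n1|exact: cond_exp_bounded].
Qed.

(** The [h j] with [j < 4 ^ n.+1] span the [n]-th matrix algebra, and the terms
    of higher index are orthogonal to it. *)
Lemma partial_sum_exact n (c : matalg R n) m T : N T -> (4 ^ n.+1 <= m)%N ->
  ip (pi (partial_sum m T) (vec (iota c))) Omega = ip (T (vec (iota c))) Omega.
Proof.
move=> NT nm; pose k i := (\tr (madj c *m h n i) / \tr (madj (h n i) *m h n i))^*.
have cE : iota c = \sum_(i < 4 ^ n.+1) k i *: hA_ i.
  rewrite -{1}(madjK c) -{1}(haar_complete (madj c)) iota_madj iota_sum.
  have adj0 : cadj cs 0 = 0.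
    have := cadj_antilinear cs (-1) 0 0.
    by rewrite scaler0 addr0 rmorphN rmorph1 scaleN1r addNr.
  transitivity (\sum_(i < 4 ^ n.+1) k i *: (iota (madj (h n i)))^#).
    elim: (index_enum _) => [|i r IH]; first by rewrite !big_nil.
    by rewrite !big_cons cadj_antilinear IH.
  by apply: eq_bigr => i _; rewrite iota_madj cadjK /hA_ (haar_iota (ltn_ord i)).
rewrite cE.
rewrite [RHS](functional_sum _ _ (L := fun a => ip (T (vec a)) Omega)); last first.
  exact: functional_lin NT.1.
rewrite -(pi_comp hpi) -(gns_state hpi).
rewrite (functional_sum _ _ (L := fun a => rho (a ** _))); last first.
  by move=> a u v; rewrite cmul_linearl rho_lin.
under eq_bigr => j _.
  rewrite (functional_sum _ _ (L := fun a => rho (_ ** a))); last first.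
    by move=> a u v; rewrite cmul_linearr rho_lin.
  over.
rewrite /=.
under eq_bigr do rewrite mulr_sumr.
rewrite exchange_big /=; apply: eq_bigr => i _.
have im : (i < m)%N by exact: leq_trans (ltn_ord i) nm.
rewrite (bigD1 (Ordinal im))//= big1 => [|j ji]; last first.
  have jn : (j : nat) != i by move: ji; rewrite -val_eqE.
  by rewrite haar_rho_ortho// !mulr0.
by rewrite addr0 -/(haar_weight i) mulrCA divfK// haar_weight_neq0.
Qed.

End HyperfiniteFactor.

(** * Uniform convergence on the unit ball *)

Section UniformConvergence.
Variables (R : realType) (A : completeNormedModType R[i]) (cs : cstar A).
Variables (iota : forall n : nat, matalg R n -> A) (rho : A -> R[i]).
Variables (H : completeNormedModType R[i]) (ip : {dot H for @Num.conj R[i]}).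
Variables (pi : A -> H -> H) (Omega : H).
Hypothesis hA : cstar_inductive_limit cs iota.
Hypothesis hrho : induced_trace_state cs iota rho.
Hypothesis hpi : is_gns cs rho ip pi Omega.
Local Notation C := R[i].

Let hilb : hilbert_norm ip := gns_hilbert hpi.
Let state : is_state cs rho := hrho.1.
Local Notation "a ** b" := (cmul cs a b) (at level 40, left associativity).
Local Notation "a ^#" := (cadj cs a) (at level 2, format "a ^#").
Local Notation vec a := (pi a Omega).
Local Notation N := (commutant (commutant (range pi))).
Local Notation h n j := (haar (@rhat R) n j).

Local Notation hA_ j := (iota (h j j)).
Local Notation S m T := (partial_sum cs iota rho ip pi Omega m T).

Definition remainder m (T : H -> H) : H -> H := fun v => (-1) *: pi (S m T) v + T v.

Lemma remainder_mem m T : N T -> N (remainder m T).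
Proof.
move=> NT; apply: commutant_lin => //; first exact: commutant_bounded.
exact: piN hpi _.
Qed.

Lemma remainder_bound m T : N T -> (forall v, `|T v| <= `|v|) -> (4 <= m)%N ->
  forall v, `|remainder m T v| <= 97 * `|v|.
Proof.
move=> NT T1 m4 v; have -> : 97 = 96 + 1 :> C by rewrite natr1.
rewrite mulrDl mul1r (le_trans (ler_normD _ _))// lerD// normrZ normrN1 mul1r.
exact: (partial_sum_bound hA hrho hpi).
Qed.

Lemma remainder_exact n (c : matalg R n) m T : N T -> (4 ^ n.+1 <= m)%N ->
  ip (remainder m T (vec (iota c))) Omega = 0.
Proof.
move=> NT nm; rewrite ipDl ipZl (partial_sum_exact hA hrho hpi c NT nm).
by rewrite mulN1r addNr.
Qed.

(** Exactness on the dense set of the [pi (iota c) Omega], and the uniform bound. *)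
Lemma remainder_weak xi eta (e : C) : 0 < e -> exists N0 : nat,
  forall m T, (N0 <= m)%N -> N T -> (forall v, `|T v| <= `|v|) ->
    `|ip (remainder m T xi) eta| <= e.
Proof.
move=> e0.
(* The summand 1 keeps the denominator nonzero for [v = 0]. *)
have pos (v : H) : 0 < e / 2 / (97 * (`|v| + 1)).
  by rewrite !divr_gt0// mulr_gt0// ltr_wpDl.
have [n [c hc]] := vec_iota_approx hA hrho hpi xi (pos eta).
set p := vec (iota c) in hc.
(* The approximation of [eta] is chosen after that of [xi], relative to its norm. *)
have [n' [d hd]] := vec_iota_approx hA hrho hpi eta (pos p).
set q := vec (iota d) in hd.
exists (4 + 4 ^ (n + n').+1)%N => m T Nm NT T1.
have m4 : (4 <= m)%N by exact: leq_trans (leq_addr _ _) Nm.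
have mn : (4 ^ (n + n').+1 <= m)%N by exact: leq_trans (leq_addl _ _) Nm.
have ND := remainder_mem m NT; have hD := remainder_bound NT T1 m4.
set D := remainder m T in ND hD *.
have D0 : ip (D p) q = 0.
  rewrite (ip_vec_trace hA hrho hpi)// -(iota_madj hA).
  have [c' _ <-] := iota_raise hA (m := (n + n')%N) (P := fun _ _ => True) (x := c)
    (leq_addr _ _) I ltac:(by []).
  have [d' _ <-] := iota_raise hA (m := (n + n')%N) (P := fun _ _ => True)
    (x := madj d) (leq_addl _ _) I ltac:(by []).
  by rewrite -(iota_mul hA) remainder_exact.
have -> : ip (D xi) eta = ip (D (xi - p)) eta + ip (D p) (eta - q).
  by rewrite (bopB ND.1) ipBl ipBr D0 subr0 subrK.
have half (u v w : H) : `|v| <= e / 2 / (97 * (`|w| + 1)) -> `|u| <= 97 * `|v| ->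
    `|u| * `|w| <= e / 2.
  move=> hv hu; rewrite (le_trans (ler_wpM2r _ hu))//.
  rewrite (@le_trans _ _ (97 * `|v| * (`|w| + 1)))//.
    by rewrite ler_wpM2l ?mulr_ge0// lerDl.
  rewrite mulrAC -[97 * _ * _]mulrC -ler_pdivlMr ?mulr_gt0 ?ltr_wpDl//.
rewrite [leRHS]splitr (le_trans (ler_normD _ _))// lerD//.
  rewrite (le_trans (cauchy_schwarz hilb _ _))//.
  exact: half hc (hD _).
rewrite (le_trans (cauchy_schwarz hilb _ _))// (le_trans (ler_wpM2r _ (hD _)))//.
rewrite -mulrA [`|p| * _]mulrC mulrA.
have := half (97 *: (eta - q)) (eta - q) p hd; rewrite normrZ normr_nat; exact.
Qed.

Lemma remainder_weak_sum (xi eta : nat -> H) K (e : C) : 0 < e -> exists N0 : nat,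
  forall m T, (N0 <= m)%N -> N T -> (forall v, `|T v| <= `|v|) ->
    `|\sum_(0 <= k < K) ip (remainder m T (xi k)) (eta k)| <= e.
Proof.
elim: K e => [|K IH] e e0.
  by exists 0%N => m T *; rewrite big_geq// normr0 ltW.
have e2 : 0 < e / 2 by rewrite divr_gt0.
have [N1 h1] := IH _ e2; have [N2 h2] := remainder_weak (xi K) (eta K) e2.
exists (N1 + N2)%N => m T Nm NT T1; rewrite big_nat_recr//=.
rewrite [leRHS]splitr (le_trans (ler_normD _ _))// lerD//.
  by apply: h1 => //; exact: leq_trans (leq_addr _ _) Nm.
by apply: h2 => //; exact: leq_trans (leq_addl _ _) Nm.
Qed.

(** Completeness of the scalars, read off the line spanned by [Omega]. *)
Lemma scalar_cauchy_cvg (u : nat -> C^o) :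
  (forall e : C, 0 < e -> exists N0 : nat, forall m n, (N0 <= m)%N -> (N0 <= n)%N ->
     `|u m - u n| <= e) -> exists l : C^o, u @ \oo --> l.
Proof.
move=> hu; have nO := norm_Omega state hpi.
have [|l hl] := @cauchy_limit R H (fun n => u n *: Omega).
  move=> e e0; have [N0 hN] := hu e e0; exists N0 => m n Nm Nn.
  by rewrite -scalerBl normrZ nO mulr1 hN.
exists (ip l Omega); apply/cvgrPdist_le => e e0.
have [N0 hN] := hl e e0; exists N0 => // n /= Nn; rewrite distrC.
have -> : u n = ip (u n *: Omega) Omega by rewrite ipZl hilb nO expr1n mulr1.
by rewrite -ipBl (le_trans (cauchy_schwarz hilb _ _))// nO mulr1 hN.
Qed.

Lemma square_summable_tail (xi : nat -> H) (e : C) : square_summable xi -> 0 < e ->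
  exists K0 : nat, forall K, (K0 <= K)%N -> \sum_(K0 <= k < K) `|xi k| ^+ 2 <= e.
Proof.
move=> /cvg_ex[l /cvgrPdist_le hl] e0.
have e2 : 0 < e / 2 by rewrite divr_gt0.
have [K0 _ hK] := hl _ e2; exists K0 => K KK.
have -> : \sum_(K0 <= k < K) `|xi k| ^+ 2 =
    `|series (fun n => `|xi n| ^+ 2 : C^o) K - series (fun n => `|xi n| ^+ 2 : C^o) K0|.
  rewrite sub_series_geq// ger0_norm//; apply: sumr_ge0 => k _; exact: exprn_ge0.
rewrite [leRHS]splitr (le_trans (ler_distD l _ _))// lerD ?hK//=.
  by rewrite distrC hK.
Qed.

(** The tail of the series is bounded by [B] times that of the square-summable
    series of norms. *)
Lemma omega_bound (p : (nat -> H) * (nat -> H)) (B e : C) :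
  square_summable p.1 -> square_summable p.2 -> 0 < B -> 0 < e ->
  exists K0 : nat, forall X : H -> H, (forall v, `|X v| <= B * `|v|) ->
    `|omega_uw ip p X| <= `|\sum_(0 <= k < K0) ip (X (p.1 k)) (p.2 k)| + B * e.
Proof.
move=> s1 s2 B0 e0.
have tail (d : C) : 0 < d -> exists K0 : nat, forall K, (K0 <= K)%N ->
    \sum_(K0 <= k < K) (`|p.1 k| ^+ 2 + `|p.2 k| ^+ 2) <= d.
  move=> d0; have d2 : 0 < d / 2 by rewrite divr_gt0.
  have [K1 h1] := square_summable_tail s1 d2; have [K2 h2] := square_summable_tail s2 d2.
  exists (maxn K1 K2) => K; rewrite geq_max => /andP[k1 k2].
  rewrite big_split [leRHS]splitr lerD//.
    apply: le_trans (h1 K k1).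
    rewrite [leRHS](@big_cat_nat _ _ _ (maxn K1 K2)) ?leq_maxl ?geq_max ?k1//=.
    by rewrite lerDr; apply: sumr_ge0 => k _; exact: exprn_ge0.
  apply: le_trans (h2 K k2).
  rewrite [leRHS](@big_cat_nat _ _ _ (maxn K1 K2)) ?leq_maxr ?geq_max ?k1//=.
  by rewrite lerDr; apply: sumr_ge0 => k _; exact: exprn_ge0.
have [K0 hK0] := tail _ e0; exists K0 => X hX.
pose s : nat -> C^o := series (fun n => ip (X (p.1 n)) (p.2 n) : C^o).
have sB K' K : (K' <= K)%N ->
    `|s K - s K'| <= B * \sum_(K' <= k < K) (`|p.1 k| ^+ 2 + `|p.2 k| ^+ 2).
  move=> KK; rewrite sub_series_geq// mulr_sumr (le_trans (ler_norm_sum _ _ _))//.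
  apply: ler_sum => k _; rewrite (le_trans (cauchy_schwarz hilb _ _))//.
  rewrite (le_trans (ler_wpM2r _ (hX _)))// -mulrA ler_pM2l//.
  exact: mulr_le_sumsq.
have [l sl] : exists l : C^o, s @ \oo --> l.
  apply: scalar_cauchy_cvg => d d0.
  have d2 : 0 < d / 2 / B by rewrite !divr_gt0.
  have [K1 h1] := tail _ d2; exists K1 => m n Km Kn.
  rewrite [leRHS]splitr (le_trans (ler_distD (s K1) _ _))// lerD//.
    by rewrite (le_trans (sB _ _ Km))// mulrC -ler_pdivlMr// h1.
  by rewrite distrC (le_trans (sB _ _ Kn))// mulrC -ler_pdivlMr// h1.
have -> : omega_uw ip p X = l by apply: cvg_lim => //; exact: norm_hausdorff.
apply/ler_addgt0Pr => d d0; move/cvgrPdist_le: sl => /(_ d d0)[K1 _ hK1].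
pose K := maxn K0 K1.
rewrite -[l](subrK (s K)) addrC (le_trans (ler_normD _ _))// addrC [leRHS]addrC.
apply: lerD; first by apply: hK1; exact: leq_maxr.
rewrite -[s K](subrK (s K0)) addrC (le_trans (ler_normD _ _))// lerD//.
rewrite (le_trans (sB _ _ (leq_maxl _ _)))// ler_pM2l//.
by apply: hK0; exact: leq_maxl.
Qed.

Lemma remainder_omega (p : (nat -> H) * (nat -> H)) (e : C) :
  square_summable p.1 -> square_summable p.2 -> 0 < e -> exists N0 : nat,
  forall m T, (N0 <= m)%N -> N T -> (forall v, `|T v| <= `|v|) ->
    `|omega_uw ip p (remainder m T)| <= e.
Proof.
move=> s1 s2 e0.
have e2 : 0 < e / 2 by rewrite divr_gt0.
have e3 : 0 < e / 2 / 97 by rewrite !divr_gt0.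
have [//|K0 hK] := @omega_bound p 97 _ s1 s2 _ e3.
have [N0 hN] := remainder_weak_sum p.1 p.2 K0 e2.
exists (4 + N0)%N => m T Nm NT T1.
have m4 : (4 <= m)%N by exact: leq_trans (leq_addr _ _) Nm.
rewrite (le_trans (hK _ (remainder_bound NT T1 m4)))// [leRHS]splitr lerD//.
  by apply: hN => //; exact: leq_trans (leq_addl _ _) Nm.
by rewrite mulrC divfK// pnatr_eq0.
Qed.

End UniformConvergence.

(** * The predual and the Schauder basis *)

Section ExtendedReals.
Variable R : realType.
Implicit Types u : nat -> \bar R.

Lemma cvg_ereal0 u : (forall n, 0 <= u n)%E ->
  (forall e : R, 0 < e -> exists N0 : nat, forall n, (N0 <= n)%N -> (u n <= e%:E)%E) ->
  u @ \oo --> 0%E.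
Proof.
move=> u0 h; apply/fine_cvgP; split.
  have [N0 hN] := h 1 ltr01; exists N0 => // n /= Nn.
  by rewrite ge0_fin_numE// (le_lt_trans (hN _ Nn))// ltry.
apply/cvgrPdist_le => e e0; have [N0 hN] := h e e0; exists N0 => // n /= Nn.
rewrite sub0r normrN ger0_norm ?fine_ge0// -lee_fin fineK ?hN//.
by rewrite ge0_fin_numE// (le_lt_trans (hN _ Nn))// ltry.
Qed.

Lemma cvg_ereal0_le u (e : R) : u @ \oo --> 0%E -> 0 < e ->
  exists N0 : nat, forall n, (N0 <= n)%N -> (u n <= e%:E)%E.
Proof.
move=> /fine_cvgP[[N1 _ h1]] /cvgrPdist_le h2 e0.
have [N2 _ h2'] := h2 e e0.
exists (maxn N1 N2) => n; rewrite geq_max => /andP[n1 n2].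
have := h2' n n2; rewrite /= sub0r normrN => /(le_trans (ler_norm _)).
by rewrite -lee_fin fineK// h1.
Qed.

End ExtendedReals.

Section Predual.
Variables (R : realType) (A : completeNormedModType R[i]) (cs : cstar A).
Variables (iota : forall n : nat, matalg R n -> A) (rho : A -> R[i]).
Variables (H : completeNormedModType R[i]) (ip : {dot H for @Num.conj R[i]}).
Variables (pi : A -> H -> H) (Omega : H).
Hypothesis hA : cstar_inductive_limit cs iota.
Hypothesis hrho : induced_trace_state cs iota rho.
Hypothesis hpi : is_gns cs rho ip pi Omega.
Local Notation C := R[i].

Let bpi a : bounded_operator (pi a) := gns_bounded hpi a.
Local Notation "a ** b" := (cmul cs a b) (at level 40, left associativity).
Local Notation "a ^#" := (cadj cs a) (at level 2, format "a ^#").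
Local Notation vec a := (pi a Omega).
Local Notation N := (commutant (commutant (range pi))).
Local Notation h n j := (haar (@rhat R) n j).

Local Notation hA_ j := (iota (h j j)).
Local Notation M := (gns_factor ip pi).
Local Notation D m T := (remainder cs iota rho ip pi Omega m T).
Local Notation w j := (haar_weight cs iota rho j).

Lemma factor_mem T : N T -> T \in M.
Proof. by rewrite (gns_factorE hpi); exact: mem_set. Qed.

Definition in_factor T (NT : N T) : M := SigSub (factor_mem NT).

Lemma factorP (x : M) : N (val x).
Proof.
have sub : M `<=` N by rewrite (gns_factorE hpi).
exact: sub (set_mem (valP x)).
Qed.

Let pi_ a : M := in_factor (piN hpi a).

Lemma embedE (x y : M) : embed Omega x y = ip (val y (val x Omega)) Omega.
Proof. by []. Qed.

Lemma omega_first (X : H -> H) u v :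
  omega_uw ip (fun n => if n == 0%N then u else 0, fun n => if n == 0%N then v else 0) X
  = ip (X u) v.
Proof.
apply: cvg_lim; first exact: norm_hausdorff.
apply: cvg_near_cst; exists 1%N => // n /= n0; apply/eqP.
rewrite /series /= -(prednK n0) big_nat_recl//= big1 ?addr0// => k _.
by rewrite ip0r.
Qed.

Lemma square_summable_first u : square_summable (fun n => if n == 0%N then u : H else 0).
Proof.
apply/cvg_ex; exists (`|u| ^+ 2); apply: cvg_near_cst; exists 1%N => // n /= n0; apply/eqP.
rewrite /series /= -(prednK n0) big_nat_recl//= big1 ?addr0// => k _.
by rewrite normr0 expr0n.
Qed.

Lemma embed_predual (x : M) : predual ip (embed Omega x).
Proof.
split=> [c y y' z hz|x0 eps eps0].
  by rewrite !embedE hz ipDl ipZl.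
exists [:: (fun n => if n == 0%N then val x Omega else 0,
            fun n => if n == 0%N then Omega else 0)], eps; split=> // [p|y hy].
  by rewrite inE => /eqP -> /=; split; exact: square_summable_first.
by have := hy _ (mem_head _ _); rewrite !omega_first.
Qed.

(** Testing against [pi a^*] shows that [x Omega = y Omega], and [Omega] is
    separating. *)
Lemma embed_injective : injective (fun x : M => embed Omega x).
Proof.
move=> x y xy; apply: val_inj => /=.
apply: (Omega_separating (rho_tracial hA hrho) hpi (factorP x) (factorP y)).
apply: (@eq_dot_vec _ _ _ _ _ _ _ _ hpi) => a.
have := congr1 (fun f => f (pi_ (a^#))) xy.
by rewrite !embedE /= !(gns_adj hpi) cadjK.
Qed.

Lemma rho_vec_tracial (x y : M) :
  rho_vec ip Omega (val y \o val x) = rho_vec ip Omega (val x \o val y).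
Proof.
exact: (double_commutant_tracial (rho_tracial hA hrho) hpi (factorP x) (factorP y)).
Qed.

Section Functional.
Variable phi : M -> C^o.
Hypothesis hphi : predual ip phi.

Lemma predual_pi_lin c a b : phi (pi_ (c *: a + b)) = c * phi (pi_ a) + phi (pi_ b).
Proof. by apply: hphi.1 => xi /=; rewrite (gns_linear hpi). Qed.

Lemma pi0 v : pi 0 v = 0.
Proof.
have := gns_linear hpi (-1) 0 0 v.
by rewrite scaler0 addr0 scaleN1r addNr.
Qed.

Lemma predual_pi0 : phi (pi_ 0) = 0.
Proof.
by have := predual_pi_lin (-1) 0 0; rewrite scaler0 addr0 mulN1r addNr.
Qed.

(** Finitely many [omega_uw] control [phi] near [0]. *)
Lemma predual_remainder (e : R) : 0 < e -> exists N0 : nat,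
  forall m (x : M), (N0 <= m)%N -> (forall v, `|val x v| <= `|v|) ->
    `|phi (in_factor (remainder_mem iota hpi m (factorP x)))| <= e%:C.
Proof.
move=> e0; have [s [d [d0 hs hd]]] := hphi.2 (pi_ 0) e e0.
have omega0 p : omega_uw ip p (pi 0) = 0.
  rewrite /omega_uw; under eq_fun do rewrite pi0 ip0l.
  apply: cvg_lim; first exact: norm_hausdorff.
  rewrite (_ : series _ = fun=> 0); first exact: cvg_cst.
  by apply/funext => n; rewrite /series /= big1.
have d2 : 0 < (d / 2)%:C :> C by rewrite ltcR divr_gt0.
have [N0 hN] : exists N0 : nat, forall m (x : M), (N0 <= m)%N ->
    (forall v, `|val x v| <= `|v|) ->
    forall p, p \in s -> `|omega_uw ip p (D m (val x))| <= (d / 2)%:C.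
  elim: (s) hs => [|p s' IH] hs'; first by exists 0%N.
  have [|N1 h1] := IH; first by move=> q qs; apply: hs'; rewrite inE qs orbT.
  have [s1 s2] := hs' p (mem_head _ _).
  have [N2 h2] := remainder_omega hA hrho hpi s1 s2 d2.
  exists (N1 + N2)%N => m x Nm x1 q; rewrite inE => /orP[/eqP ->|qs].
    by apply: h2 => //; [exact: leq_trans (leq_addl _ _) Nm|exact: factorP].
  by apply: h1 => //; exact: leq_trans (leq_addr _ _) Nm.
exists N0 => m x Nm x1; have := hd (in_factor (remainder_mem iota hpi m (factorP x))).
rewrite predual_pi0 subr0 => h'; apply/ltW/h' => p ps /=.
rewrite omega0 subr0 (le_lt_trans (hN m x Nm x1 p ps))// ltcR.
by rewrite ltr_pdivrMr// ltr_pMr// ltr1n.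
Qed.

Definition haar_coef j : C := phi (pi_ ((hA_ j)^#)) / w j.

Lemma predual_partial_sum (k : nat -> C) n (x : M) :
  (phi - \sum_(j < n) k j *: embed Omega (haar_factor iota ip pi (@rhat R) j)) x =
  phi x - \sum_(j < n) k j * ip (val x (vec (hA_ j))) Omega.
Proof.
have := functional_sum (index_enum 'I_n) (fun j => k j)
  (fun j => embed Omega (haar_factor iota ip pi (@rhat R) j))
  (L := fun f : M -> C^o => f x) (fun _ _ _ => erefl).
by move=> e; rewrite -[RHS]/(phi x - _) -e.
Qed.

Lemma predual_remainderE m (x : M) :
  (phi - \sum_(j < m) haar_coef j *: embed Omega (haar_factor iota ip pi (@rhat R) j)) x =
  phi (in_factor (remainder_mem iota hpi m (factorP x))).
Proof.
rewrite predual_partial_sum.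
rewrite (hphi.1 (-1) (pi_ (partial_sum cs iota rho ip pi Omega m (val x))) x
  (in_factor (remainder_mem iota hpi m (factorP x))))//.
rewrite (functional_sum _ _ _ (L := fun a => phi (pi_ a)) predual_pi_lin).
rewrite mulN1r [RHS]addrC; congr (phi x + - _); apply: eq_bigr => j _.
by rewrite /haar_coef [RHS]mulrC mulrA mulrAC.
Qed.

Lemma haar_coef_cvg : (fun n => dual_norm (phi - \sum_(j < n) haar_coef j *:
  embed Omega (haar_factor iota ip pi (@rhat R) j))) @ \oo --> 0%E.
Proof.
apply: cvg_ereal0 => [n|e e0].
  apply: ereal_sup_ubound; exists (pi_ 0); first by move=> xi; rewrite [val _ _]pi0 normr0.
  rewrite predual_partial_sum predual_pi0 big1 => [|j _].
    by rewrite subr0 normr0.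
  by rewrite /= pi0 ip0l mulr0.
have [N0 hN] := predual_remainder e0; exists N0 => m Nm.
apply: ge_ereal_sup => _ [x x1 <-]; rewrite lee_fin -lecR Re_norm predual_remainderE.
exact: hN.
Qed.

(** The [h_j] are orthogonal, so [k j] is read off by evaluating at
    [h_j^*]. *)
Lemma haar_coef_unique (k : nat -> C) :
  (fun n => dual_norm (phi - \sum_(j < n) k j *:
    embed Omega (haar_factor iota ip pi (@rhat R) j))) @ \oo --> 0%E ->
  haar_coef = k.
Proof.
move=> hk; apply/funext => i.
have [B B0 hB] := bounded_operator_bound (bpi (hA_ i)^#).
suff : phi (pi_ (hA_ i)^#) - k i * w i = 0.
  move=> /eqP; rewrite subr_eq0 => /eqP e.
  by rewrite /haar_coef e mulfK// haar_weight_neq0.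
apply: (@eq0_small _ _ _ B) => [|_ /ltC0P[e e0 ->]]; first exact: ltW.
have [N0 hN] := cvg_ereal0_le hk e0.
(* The factor [B^-1] brings [pi h_i^*] into the unit ball. *)
pose n := (N0 + i.+1)%N; pose x := pi_ (B^-1 *: (hA_ i)^#).
have xE v : val x v = B^-1 *: pi (hA_ i)^# v.
  have := gns_linear hpi B^-1 (hA_ i)^# 0 v; rewrite pi0 !addr0; exact.
have x1 v : `|val x v| <= `|v|.
  rewrite xE normrZ gtr0_norm ?invr_gt0// mulrC ler_pdivrMr// mulrC; exact: hB.
have h1 : ((complex.Re `|(phi - \sum_(j < n) k j *:
    embed Omega (haar_factor iota ip pi (@rhat R) j)) x|)%:E <= e%:E)%E.
  apply: le_trans (hN n (leq_addr _ _)).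
  by apply: ereal_sup_ubound; exists x.
move: h1; rewrite lee_fin -lecR Re_norm predual_partial_sum.
have -> : phi x = B^-1 * phi (pi_ (hA_ i)^#).
  by have := predual_pi_lin B^-1 (hA_ i)^# 0; rewrite predual_pi0 !addr0.
have ni : (i < n)%N by rewrite leq_addl.
have term j : ip (val x (vec (hA_ j))) Omega = B^-1 * rho ((hA_ i)^# ** hA_ j).
  by rewrite xE ipZl -(pi_comp hpi) -(gns_state hpi).
under eq_bigr do rewrite term.
rewrite (bigD1 (Ordinal ni))//= big1 => [|j ji]; last first.
  have ij : i != j by move: ji; rewrite -val_eqE eq_sym.
  by rewrite (haar_rho_ortho hA hrho ij) !mulr0.
rewrite addr0 mulrCA -mulrBr normrM gtr0_norm ?invr_gt0//.
by rewrite ler_pdivrMl.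
Qed.

End Functional.

End Predual.

Theorem corollary14 (R : realType)
    (A : completeNormedModType R[i]) (cs : cstar A)
    (iota : forall n : nat, matalg R n -> A) (rho : A -> R[i])
    (H : completeNormedModType R[i]) (ip : {dot H for @Num.conj R[i]})
    (pi : A -> H -> H) (Omega : H)
    (hA : cstar_inductive_limit cs iota)
    (hrho : induced_trace_state cs iota rho)
    (hpi : is_gns cs rho ip pi Omega) :
  [/\ forall x : gns_factor ip pi, predual ip (embed Omega x),
      injective (fun x : gns_factor ip pi => embed Omega x),
      forall x y : gns_factor ip pi,
        rho_vec ip Omega (val y \o val x) = rho_vec ip Omega (val x \o val y) &
      schauder_basis (predual ip (M := gns_factor ip pi))
        (dual_norm (M := gns_factor ip pi))
        (fun j => embed Omega (haar_factor iota ip pi (@rhat R) j))].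
Proof.
split.
- by move=> x; exact: embed_predual.
- exact: embed_injective hA hrho hpi.
- exact: rho_vec_tracial hA hrho hpi.
- split=> [j|phi hphi]; first exact: embed_predual.
  exists (haar_coef iota hpi phi); split; first exact: (haar_coef_cvg hA hrho hpi hphi).
  by move=> k; exact: (haar_coef_unique hA hrho hpi hphi).
Qed.
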